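(* Let $G$ be a semisimple Lie group with Killing form metric $\kappa$ and Cartan connections $\nabla^\pm$, and let $\varpi^\pm$ be the (globally defined) solution bi-forms of $(G,\kappa,\nabla^\pm)$. Then: (a) the bi-form $\varpi^+$ is left-invariant, i.e. for any $(x,y),(z_1,z_2)\in G\times G$ one has $\varpi^+(z_1\cdot x,z_2\cdot y)=\varpi^+(x,y)$; moreover, $\varpi^+$ is the unique left-invariant contrast bi-form integrating $(G,\kappa,\nabla^+)$, i.e. the unique left-invariant contrast bi-form $\varpi$ on $G\times G$ with $g^\varpi=\kappa$ and $\nabla^\varpi=\nabla^+$; (b) the bi-form $\varpi^-$ is diagonally left-invariant, i.e. for any $x,y,z\in G$ one has $\varpi^-(z\cdot x,z\cdot y)=\varpi^-(x,y)$. Here $\varpi(x',y')=\varpi(x,y)$ means $\varpi(X\mid Y)(x',y')=\varpi(X\mid Y)(x,y)$ for all left-invariant vector fields $X,Y$ on $G$.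
   Context: Manifolds are finite-dimensional, paracompact and connected. $G$ is a (connected) semisimple Lie group with Lie algebra $\mathfrak g$, identified with the left-invariant vector fields. $L_z(x)=z\cdot x$ and $R_z(x)=x\cdot z$. The Killing form $\kappa(X,Y)=\mathrm{Tr}(\mathrm{ad}_X\circ\mathrm{ad}_Y)$, $X,Y\in\mathfrak g$, is nondegenerate and defines a bi-invariant pseudo-Riemannian metric on $G$, also denoted $\kappa$. The Cartan connections $\nabla^+$ and $\nabla^-$ are the left-invariant affine connections on $G$ determined by $\nabla^+_XY=0$ and $\nabla^-_XY=[X,Y]$ for $X,Y\in\mathfrak g$. They are curvature-free and have path-independent parallel transport: $P^{\nabla^+}_{y\leftarrow x}=(L_{y\cdot x^{-1}})'_x$ and $P^{\nabla^-}_{y\leftarrow x}=(R_{y\cdot x^{-1}})'_x$ from $T_xG$ to $T_yG$. A $(1,1)$-bi-form on $G$ is a smooth section of $\pi_L^*T^*G\otimes\pi_R^*T^*G\to G\times G$, where $\pi_L,\pi_R\colon G\times G\to G$ are the projections; for vector fields, $\varpi(X\mid Y)(x,y)=\varpi_{(x,y)}(X_x\mid Y_y)$. The solution bi-forms are the globally defined $(1,1)$-bi-forms $$\varpi^\pm(X\mid Y)(x,y)=\kappa_y\big(P^{\nabla^\pm}_{y\leftarrow x}X_x,\,Y_y\big),\qquad (x,y)\in G\times G.$$ For a $(1,1)$-bi-form $\varpi$, $\varpi_{\restriction\Delta_G}(X,Y)=\iota^*(\varpi(X\mid Y))$ with $\iota(x)=(x,x)$; $\varpi$ is a contrast bi-form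 if $g^\varpi:=\varpi_{\restriction\Delta_G}$ is a pseudo-Riemannian metric, and then $\nabla^\varpi$ is the affine connection defined by $g^\varpi(\nabla^\varpi_ZX,Y)=(\mathcal L_{Z\mid}\varpi)_{\restriction\Delta_G}(X,Y)+g^\varpi([Z,X],Y)$, where $(\mathcal L_{Z\mid}\varpi)(X\mid Y)=\mathcal L_{Z^L}(\varpi(X\mid Y))-\varpi([Z,X]\mid Y)$ and $Z^L=(Z,0)\in\mathfrak X(G\times G)$. *)

(* Defs.v *)
From HB Require Import structures.
From mathcomp Require Import all_boot all_order all_algebra.
From mathcomp Require Import all_classical all_reals topology normedtype derive.

Set Implicit Arguments.
Unset Strict Implicit.
Unset Printing Implicit Defensive.

Import Order.TTheory GRing.Theory Num.Theory.
Import numFieldNormedType.Exports.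

Local Open Scope classical_set_scope.
Local Open Scope ring_scope.

(* A type with a topology and a group law; the continuity of the law is part
   of [lie_group] below. *)
#[short(type="topologicalGroupCarrierType")]
HB.structure Definition TopologicalGroupCarrier :=
  {G of Topological G & Group G}.

Section Smooth.
Context {R : realType} {V W : normedModType R}.

(* [V] is meant to be finite-dimensional and [U] to be open. *)
Fixpoint Ck (k : nat) (U : set V) (f : V -> W) : Prop :=
  match k with
  | 0 => forall x, U x -> {for x, continuous f}
  | k'.+1 => (forall x, U x -> differentiable f x) /\
             (forall v, Ck k' U ('D_v f))
  end.

Definition smooth_on (U : set V) (f : V -> W) := forall k, Ck k U f.

End Smooth.

Definition paracompact (T : topologicalType) :=
  forall U : set (set T),
    (forall A, U A -> open A) -> \bigcup_(A in U) A = setT ->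
  exists V : set (set T),
    [/\ forall B, V B -> open B,
        \bigcup_(B in V) B = setT,
        forall B, V B -> exists2 A, U A & B `<=` A
      & forall x : T, exists2 N, nbhs x N &
          finite_set [set B | V B /\ B `&` N !=set0]].

Section Manifold.
Context {R : realType} {n : nat} {M : topologicalType}.

Record chart := Chart {
  cdom : set M;
  cfun :> M -> 'rV[R]_n;
  cinv : 'rV[R]_n -> M;
  cdom_open : open cdom;
  cran_open : open (cfun @` cdom);
  cfunK : forall x, cdom x -> cinv (cfun x) = x;
  cfun_cont : forall x, cdom x -> {for x, continuous cfun};
  cinv_cont : forall p, (cfun @` cdom) p -> {for p, continuous cinv} }.

Definition cran (phi : chart) : set 'rV[R]_n := phi @` cdom phi.

(* Besides an atlas, a manifold comes with a preferred chart around each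
   point.  It is only used to encode tangent vectors: the tangent space at [x]
   is ['rV[R]_n], and [v] stands for the tangent vector at [x] with
   components [v] in the chart [chart_at x]. *)
Record manifold := Manifold {
  atlas : set chart;
  atlas_smooth : forall phi psi, atlas phi -> atlas psi ->
    smooth_on [set p | cran phi p /\ cdom psi (cinv phi p)]
              (psi \o cinv phi);
  chart_at : M -> chart;
  chart_at_atlas : forall x, atlas (chart_at x);
  chart_at_dom : forall x, cdom (chart_at x) x;
  mfd_hausdorff : hausdorff_space M;
  mfd_connected : connected [set: M];
  mfd_paracompact : paracompact M }.

End Manifold.
Arguments chart : clear implicits.
Arguments manifold : clear implicits.

Section Calculus.
Context {R : realType} {n : nat} {M : topologicalType}.
Variable A : manifold R n M.

Local Notation vect := 'rV[R]_n.

Definition smooth_fun (f : M -> R) :=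
  forall phi, atlas A phi -> smooth_on (cran phi) (f \o cinv phi : vect -> R^o).

(* Components in [phi] of the tangent vector [v] at [x]. *)
Definition coord (phi : chart R n M) (x : M) (v : vect) : vect :=
  'd (phi \o cinv (chart_at A x)) (chart_at A x x) v.

(* The tangent vector at [x] whose components in [phi] are [u]. *)
Definition of_coord (phi : chart R n M) (x : M) (u : vect) : vect :=
  'd (chart_at A x \o cinv phi) (phi x) u.

Definition vfield := M -> vect.

Definition local_rep (phi : chart R n M) (X : vfield) (p : vect) : vect :=
  coord phi (cinv phi p) (X (cinv phi p)).

Definition smooth_vf (X : vfield) :=
  forall phi, atlas A phi -> smooth_on (cran phi) (local_rep phi X).

(* X f *)
Definition lie_deriv (X : vfield) (f : M -> R) (x : M) : R :=
  'D_(X x) (f \o cinv (chart_at A x) : vect -> R^o) (chart_at A x x).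

(* [X, Y]^i = X^j d_j Y^i - Y^j d_j X^i in the chart [chart_at A x],
   i.e. [X, Y] f = X (Y f) - Y (X f). *)
Definition bracket (X Y : vfield) : vfield := fun x =>
  let phi := chart_at A x in
  'D_(X x) (local_rep phi Y) (phi x) - 'D_(Y x) (local_rep phi X) (phi x).

Definition tangent_map (F : M -> M) (x : M) (v : vect) : vect :=
  'd (chart_at A (F x) \o F \o cinv (chart_at A x)) (chart_at A x x) v.

Definition smooth_curve (c : R -> M) :=
  continuous c /\
  forall phi, atlas A phi ->
    smooth_on [set t : R^o | cdom phi (c t)] (phi \o c : R^o -> vect).

Definition velocity (c : R -> M) (t : R) : vect :=
  derive1 (chart_at A (c t) \o c) t.

Definition bilinear_form (b : vect -> vect -> R) :=
  (forall w, scalar (b^~ w)) /\ (forall v, scalar (b v)).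

(* [g x v w] is the value of the tensor at [x] on tangent vectors [v], [w]. *)
Definition tensor2 := M -> vect -> vect -> R.

Definition pseudo_riemannian (g : tensor2) :=
  [/\ forall x, bilinear_form (g x),
      forall x v w, g x v w = g x w v,
      forall x v, (forall w, g x v w = 0) -> v = 0
    & forall phi, atlas A phi -> forall v w : vect,
        smooth_on (cran phi) (fun p : vect => let x := cinv phi p in
          g x (of_coord phi x v) (of_coord phi x w) : R^o)].

Definition connection := vfield -> vfield -> vfield.

(* [nabla Z X] is the covariant derivative of X along Z; only its values on
   smooth vector fields are meaningful. *)
Definition affine_connection (nabla : connection) :=
  [/\ forall Z X, smooth_vf Z -> smooth_vf X -> smooth_vf (nabla Z X),
      forall Z1 Z2 X, smooth_vf Z1 -> smooth_vf Z2 -> smooth_vf X ->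
        forall x, nabla (fun y => Z1 y + Z2 y) X x
                  = nabla Z1 X x + nabla Z2 X x,
      forall f Z X, smooth_fun f -> smooth_vf Z -> smooth_vf X ->
        forall x, nabla (fun y => f y *: Z y) X x = f x *: nabla Z X x,
      forall Z X1 X2, smooth_vf Z -> smooth_vf X1 -> smooth_vf X2 ->
        forall x, nabla Z (fun y => X1 y + X2 y) x
                  = nabla Z X1 x + nabla Z X2 x
    & forall f Z X, smooth_fun f -> smooth_vf Z -> smooth_vf X ->
        forall x, nabla Z (fun y => f y *: X y) x
                  = lie_deriv Z f x *: X x + f x *: nabla Z X x].

(* [w x y v u] is the value at (x, y) on [v] tangent at [x] and [u] tangent
   at [y]. *)
Definition biform := M -> M -> vect -> vect -> R.

(* w(X | Y) *)
Definition bieval (w : biform) (X Y : vfield) (x y : M) : R :=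
  w x y (X x) (Y y).

(* Smooth sections of pi_L^* T^*M (x) pi_R^* T^*M: the components in every
   product chart of M x M are smooth. *)
Definition smooth_biform (w : biform) :=
  (forall x y, bilinear_form (w x y)) /\
  (forall phi psi, atlas A phi -> atlas A psi -> forall v u : vect,
     smooth_on (cran phi `*` cran psi)
       (fun pq : vect * vect =>
          let x := cinv phi pq.1 in let y := cinv psi pq.2 in
          w x y (of_coord phi x v) (of_coord psi y u) : R^o)).

Definition restr_diag (w : biform) : tensor2 := fun x => w x x.

(* (L_{Z|} w)(X | Y); the vector field Z^L = (Z, 0) differentiates in the
   first variable only. *)
Definition lie_left (Z : vfield) (w : biform) (X Y : vfield) (x y : M) : R :=
  lie_deriv Z (fun x' => bieval w X Y x' y) x - bieval w (bracket Z X) Y x y.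

Definition contrast_biform (w : biform) :=
  smooth_biform w /\ pseudo_riemannian (restr_diag w).

(* nabla = nabla^w *)
Definition is_contrast_connection (w : biform) (nabla : connection) :=
  affine_connection nabla /\
  forall Z X Y, smooth_vf Z -> smooth_vf X -> smooth_vf Y -> forall x,
    restr_diag w x (nabla Z X x) (Y x)
    = lie_left Z w X Y x x + restr_diag w x (bracket Z X x) (Y x).

Definition integrates (w : biform) (g : tensor2) (nabla : connection) :=
  (forall x u v, restr_diag w x u v = g x u v) /\
  is_contrast_connection w nabla.

End Calculus.

Section LieGroup.
Context {R : realType} {n : nat} {G : topologicalGroupCarrierType}.

Record lie_group := LieGroup {
  lie_manifold :> manifold R n G;
  lie_mul_cont : continuous (fun p : G * G => (p.1 * p.2)%g);
  lie_mul_smooth : forall phi psi chi, atlas lie_manifold phi ->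
    atlas lie_manifold psi -> atlas lie_manifold chi ->
    smooth_on
      [set pq : 'rV[R]_n * 'rV[R]_n | [/\ cran phi pq.1, cran psi pq.2
         & cdom chi (cinv phi pq.1 * cinv psi pq.2)%g]]
      (fun pq => chi (cinv phi pq.1 * cinv psi pq.2)%g);
  lie_inv_cont : continuous (fun x : G => (x^-1)%g);
  lie_inv_smooth : forall phi chi, atlas lie_manifold phi ->
    atlas lie_manifold chi ->
    smooth_on [set p | cran phi p /\ cdom chi (cinv phi p)^-1%g]
      (fun p => chi (cinv phi p)^-1%g) }.

Variable L : lie_group.

Local Notation vect := 'rV[R]_n.
Local Notation vfield := (@vfield R n G).
Local Notation connection := (@connection R n G).
Local Notation biform := (@biform R n G).

Definition left_invariant (X : vfield) :=
  forall z x, X (z * x)%g = tangent_map L (fun y => z * y)%g x (X x).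

(* The left-invariant vector field whose value at [x] is [v]. *)
Definition left_ext (x : G) (v : vect) : vfield := fun y =>
  tangent_map L (fun z => (y * x^-1) * z)%g x v.

(* Tr (ad_X \o ad_Y), computed on the tangent space at 1, which is isomorphic
   to the Lie algebra of left-invariant vector fields through
   [left_ext 1]. *)
Definition killing (X Y : vfield) : R :=
  \tr (lin1_mx (fun v : vect =>
         bracket L X (bracket L Y (left_ext 1%g v)) 1%g)).

Definition semisimple :=
  forall X, left_invariant X ->
    (forall Y, left_invariant Y -> killing X Y = 0) -> forall x, X x = 0.

Definition kappa : tensor2 := fun x v w =>
  killing (left_ext x v) (left_ext x w).

Definition cartan_plus (nabla : connection) :=
  affine_connection L nabla /\
  forall X Y, left_invariant X -> left_invariant Y ->
    forall x, nabla X Y x = 0.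

Definition cartan_minus (nabla : connection) :=
  affine_connection L nabla /\
  forall X Y, left_invariant X -> left_invariant Y ->
    forall x, nabla X Y x = bracket L X Y x.

Definition left_frame (i : 'I_n) : vfield := left_ext 1%g (delta_mx 0 i).

(* The field V along c has zero covariant derivative.  If V = a^i E_i along c
   with (E_i) the left-invariant frame, this derivative is
   (a^i)' E_i + a^i nabla_{c'} E_i. *)
Definition parallel_along (nabla : connection) (c : R -> G) (V : R -> vect) :=
  exists a : 'I_n -> R -> R, forall t : R,
    [/\ forall i, derivable (a i : R^o -> R^o) t 1,
        V t = \sum_i a i t *: left_frame i (c t)
      & \sum_i (derive1 (a i) t *: left_frame i (c t)
                + a i t *: nabla (left_ext (c t) (velocity L c t))
                                 (left_frame i) (c t)) = 0].

(* [w] is the parallel transport of [v] along some curve from [x] to [y]. *)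
Definition transports (nabla : connection) (x y : G) (v w : vect) :=
  exists (c : R -> G) (V : R -> vect),
    [/\ smooth_curve L c, c 0 = x, c 1 = y, parallel_along nabla c V
      & V 0 = v /\ V 1 = w].

(* Parallel transport of [nabla] is path-independent, and [P y x] is the
   parallel transport P_{y <- x}. *)
Definition is_parallel_transport (nabla : connection)
    (P : G -> G -> vect -> vect) :=
  forall x y v w, transports nabla x y v w <-> w = P y x v.

Definition solution_biform (P : G -> G -> vect -> vect) : biform :=
  fun x y v w => kappa y (P y x v) w.

Definition biform_at_eq (w : biform) (x' y' x y : G) :=
  forall X Y, left_invariant X -> left_invariant Y ->
    bieval w X Y x' y' = bieval w X Y x y.

Definition left_invariant_biform (w : biform) :=
  forall x y z1 z2 : G, biform_at_eq w (z1 * x)%g (z2 * y)%g x y.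

Definition diag_left_invariant_biform (w : biform) :=
  forall x y z : G, biform_at_eq w (z * x)%g (z * y)%g x y.

End LieGroup.
Arguments lie_group : clear implicits.

(* Main.v *)
(* Write [ell_{y <- x}] for the differential at [x] of the left translation
   taking [x] to [y].  In a left-invariant frame the parallel transport equation
   of the [+] connection says that the coefficients are constant, so its
   transport from [x] to [y] is [ell_{y <- x}] and
     varpi^+_(x,y) (v | w) = killing (V, W)
   for the left-invariant extensions V, W of v, w.  This is a constant on
   left-invariant fields, whence left-invariance, and uniqueness since such a
   bi-form is determined by its restriction to the diagonal; smoothness comes
   from that of the Maurer-Cartan form, [varpi^+] being its pullback under the
   Killing form.  For the [-] connection nothing has to be integrated: its
   coefficients in the left-invariant frame are brackets of left-invariant
   fields, hence left-invariant, so left translation maps parallel fields along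
   curves to parallel fields.  That brackets of left-invariant fields are
   left-invariant rests on the symmetry of second derivatives. *)
From HB Require Import structures.
Require Import Defs.
From mathcomp Require Import all_boot all_order all_algebra.
From mathcomp Require Import all_classical all_reals topology normedtype derive.
From mathcomp Require Import landau realfun.

Set Implicit Arguments.
Unset Strict Implicit.
Unset Printing Implicit Defensive.

Import Order.TTheory GRing.Theory Num.Theory.
Import numFieldNormedType.Exports.

(** * Differential calculus of class C^k *)

Section Differentials.
Local Open Scope classical_set_scope.
Local Open Scope ring_scope.
Context {R : realType}.
Implicit Types V W Z : normedModType R.

(** The first-order expansion of [f] at [x] is also one of [g], and the linear part of such an
    expansion is unique. *)
Lemma near_eq_is_diff V W (f g df : V -> W) (x : V) :
  (\near x, f x = g x) -> is_diff x f df -> is_diff x g df.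
Proof.
move=> fg [dfx <-].
have fgx : f x = g x by exact: nbhs_singleton fg.
have [dc E] := (diff_locallyP x f).1 dfx.
have E' : g \o shift x = cst (g x) + 'd f x +o_ 0 id.
  apply/eqaddoP => e e0; move/eqaddoP/(_ e e0) : E => E.
  have fg' : \forall h \near (0 : V), f (h + x) = g (h + x).
    move: fg; rewrite (near_shift 0 x) => /=.
    by apply: filterS => h; rewrite subr0.
  near=> h.
  suff -> : (g \o shift x - (cst (g x) + 'd f x)) h =
            (f \o shift x - (cst (f x) + 'd f x)) h by near: h.
  by rewrite /= !fctE /= /cst fgx; congr (_ - _); symmetry; near: h.
have du := diff_unique dc E'.
split; last exact: du.
by apply/diff_locallyP; rewrite du; split; [exact: dc | exact: E'].
Unshelve. all: by end_near. Qed.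

Lemma near_eq_differentiable V W (f g : V -> W) (x : V) :
  (\near x, f x = g x) -> differentiable f x -> differentiable g x.
Proof. by move=> fg /differentiableP /(near_eq_is_diff fg). Qed.

Lemma near_eq_diff V W (f g : V -> W) (x : V) :
  (\near x, f x = g x) -> differentiable f x -> 'd g x = 'd f x :> (V -> W).
Proof. by move=> fg /differentiableP /(near_eq_is_diff fg) []. Qed.

Section Scale.
Variable Z : normedModType R.
Let scale := fun (k : R) (z : Z) => k *: z.

Let scale_is_bilinear : bilinear_for
  (GRing.Scale.Law.clone _ _ *:%R _) (GRing.Scale.Law.clone _ _ *:%R _) scale.
Proof.
split=> [z|k] a x y; rewrite /scale /=; first by rewrite scalerDl scalerA.
by rewrite scalerDr !scalerA mulrC.
Qed.
HB.instance Definition _ := bilinear_isBilinear.Build R R Z Z _ _ scale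
  scale_is_bilinear.

(** The product rule, obtained as the chain rule for the pair of [a] and [h] followed by the
    bilinear map [scale]. *)
Lemma is_diff_scale V (a da : V -> R^o) (h dh : V -> Z) x :
  is_diff x a da -> is_diff x h dh ->
  is_diff x (fun y => (a y : R) *: h y) (fun v => a x *: dh v + da v *: h x).
Proof.
move=> da' dh'.
have sc : is_diff (a x : R, h x) (fun p : R * Z => scale p.1 p.2)
    (fun p => a x *: p.2 + p.1 *: h x).
  have c : continuous (fun p : R * Z => scale p.1 p.2).
    by move=> p; apply: scale_continuous.
  by split; [exact: differentiable_bilin | rewrite diff_bilin].
exact: (@is_diff_comp _ _ _ _ (fun y => (a y : R, h y)) _ _ _ x).
Qed.

End Scale.

Lemma derive_comp_linear V W Z (l : {linear W -> Z}) (f : V -> W) x v :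
  continuous l -> differentiable f x -> 'D_v (l \o f) x = l ('D_v f x).
Proof.
move=> lc df; have dl := linear_differentiable (f x) lc.
rewrite !deriveE //; last exact: differentiable_comp.
by rewrite diff_comp //= diff_lin.
Qed.

End Differentials.

(** * Closure properties of the classes [C^k] *)

Section CkCalculus.
Local Open Scope classical_set_scope.
Local Open Scope ring_scope.
Context {R : realType}.
Implicit Types V W Z : normedModType R.

Lemma Ck_subset V W k (U U' : set V) (f : V -> W) :
  U `<=` U' -> Ck k U' f -> Ck k U f.
Proof.
move=> sUU'; elim: k f => [|k IH] f /=; first by move=> cf x /sUU' /cf.
by move=> [df Df]; split=> [x /sUU' /df //|v]; exact/IH/Df.
Qed.

(** Every clause of [Ck] is pointwise, with derivatives taken in the ambient space, so the sets [U']
    may be arbitrary. *)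
Lemma Ck_local V W k (U : set V) (f : V -> W) :
  (forall x, U x -> exists2 U', U' x & Ck k U' f) -> Ck k U f.
Proof.
elim: k f => [|k IH] f /= loc; first by move=> x /loc[U' U'x /(_ x U'x)].
split=> [x /loc[U' U'x [/(_ x U'x)]] //|v].
by apply: IH => x /loc[U' U'x [_ Df]]; exists U'.
Qed.

(** Openness of [U] turns equality on [U] into equality near each of its points, which is what
    derivatives depend on. *)
Lemma Ck_eq V W k (U : set V) (f g : V -> W) :
  open U -> {in U, f =1 g} -> Ck k U f -> Ck k U g.
Proof.
move=> oU; have nearU (f' g' : V -> W) x : {in U, f' =1 g'} -> U x ->
    \near x, f' x = g' x.
  move=> fg Ux; have := open_nbhs_nbhs (conj oU Ux).
  by apply: filterS => y Uy; apply: fg; rewrite inE.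
elim: k f g => [|k IH] f g fg /=.
  move=> cf x Ux; have fx := cf x Ux.
  rewrite /prop_for /continuous_at -fg ?inE //; apply: cvg_trans fx.
  by apply: near_eq_cvg; exact: nearU.
move=> [df Df]; split=> [x Ux|v].
  by apply: near_eq_differentiable (df x Ux); exact: nearU.
apply: IH (Df v) => x; rewrite inE => Ux.
by apply: near_eq_derive; exact: nearU.
Qed.

Lemma CkW V W k (U : set V) (f : V -> W) : Ck k.+1 U f -> Ck k U f.
Proof.
elim: k f => [|k IH] f; first by move=> [df _] x /df /differentiable_continuous.
by move=> [df Df]; split=> // v; exact/IH/Df.
Qed.

Lemma Ck_cst V W k (U : set V) (c : W) : Ck k U (cst c : V -> W).
Proof.
elim: k c => [|k IH] c /=; first by move=> x _; exact: cvg_cst.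
split=> [x _|v]; first exact: differentiable_cst.
by rewrite (_ : 'D_v _ = cst 0) //; apply/funext => x; rewrite derive_cst.
Qed.

Lemma Ck_linear V W k (U : set V) (l : {linear V -> W}) :
  continuous l -> Ck k U l.
Proof.
case: k => [|k] lc /=; first by move=> x _; exact: lc.
split=> [x _|v]; first exact: linear_differentiable.
rewrite (_ : 'D_v _ = cst (l v)); first exact: Ck_cst.
apply/funext => x; rewrite deriveE ?diff_lin //.
exact: linear_differentiable.
Qed.

Lemma Ck_id V k (U : set V) : Ck k U (id : V -> V).
Proof. by apply: (@Ck_linear _ _ _ _ idfun) => x; exact: cvg_id. Qed.

Lemma Ck_comp_linear V W Z k (U : set V) (l : {linear W -> Z}) (f : V -> W) :
  open U -> continuous l -> Ck k U f -> Ck k U (l \o f).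
Proof.
move=> oU lc; elim: k f => [|k IH] f /=.
  by move=> cf x Ux; apply: continuous_comp; [exact: cf | exact: lc].
move=> [df Df]; split=> [x Ux|v].
  by apply: differentiable_comp; [exact: df | exact: linear_differentiable].
apply: Ck_eq (IH _ (Df v)) => // x; rewrite inE => Ux /=.
by rewrite derive_comp_linear //; exact: df.
Qed.

Lemma CkD V W k (U : set V) (f g : V -> W) :
  open U -> Ck k U f -> Ck k U g -> Ck k U (fun x => f x + g x).
Proof.
move=> oU; elim: k f g => [|k IH] f g /=.
  by move=> cf cg x Ux; apply: cvgD; [exact: cf | exact: cg].
move=> [df Df] [dg Dg]; split=> [x Ux|v].
  by apply: differentiableD; [exact: df | exact: dg].
apply: Ck_eq (IH _ _ (Df v) (Dg v)) => // x; rewrite inE => Ux /=.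
by rewrite [RHS]deriveD //; apply: diff_derivable; [exact: df | exact: dg].
Qed.

Lemma Ck_sum V W k (U : set V) (I : Type) (r : seq I) (f : I -> V -> W) :
  open U -> (forall i, Ck k U (f i)) -> Ck k U (fun x => \sum_(i <- r) f i x).
Proof.
move=> oU Cf; elim: r => [|i r IH].
  by under eq_fun do rewrite big_nil; exact: Ck_cst.
by under eq_fun do rewrite big_cons; exact: CkD.
Qed.

(** By the Leibniz rule the derivative is a sum of two products of the same kind; [CkW] lowers the
    order of the factor left undifferentiated, so that the induction applies. *)
Lemma CkZ V W k (U : set V) (a : V -> R^o) (h : V -> W) :
  open U -> Ck k U a -> Ck k U h -> Ck k U (fun x => (a x : R) *: h x).
Proof.
move=> oU; elim: k a h => [|k IH] a h /=.
  by move=> ca ch x Ux; apply: cvgZ; [exact: ca | exact: ch].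
move=> [da Da] [dh Dh].
have dah x : U x -> is_diff x (fun y => (a y : R) *: h y)
    (fun v => (a x : R) *: 'd h x v + ('d a x v : R) *: h x).
  by move=> Ux; apply: is_diff_scale; apply: differentiableP;
    [exact: da | exact: dh].
split=> [x /dah [] //|v].
have Ca : Ck k U a by apply: CkW; split.
have Ch : Ck k U h by apply: CkW; split.
apply: Ck_eq (CkD oU (IH _ _ Ca (Dh v)) (IH _ _ (Da v) Ch)) => // x.
rewrite inE => Ux /=; have [dx Ex] := dah x Ux.
by rewrite [RHS]deriveE // Ex !deriveE //; [exact: da | exact: dh].
Qed.

(* The [e i] need not be independent; what matters is that a differential
   is determined by its values at finitely many vectors. *)
Definition finite_frame W := exists (m : nat) (e : 'I_m -> W)
  (l : 'I_m -> {linear W -> R^o}),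
  (forall i, continuous (l i)) /\ (forall w, w = \sum_i (l i w : R) *: e i).

(** The frame puts the chain rule in the form [D_v (g o f) = sum_i l_i (D_v f) (D_(e_i) g o f)],
    where [g] is differentiated in fixed directions only; the induction hypothesis then applies to
    each [D_(e_i) g]. *)
Lemma Ck_comp V W Z k (U : set V) (U' : set W) (f : V -> W) (g : W -> Z) :
  finite_frame W -> open U -> U `<=` f @^-1` U' ->
  Ck k U f -> Ck k U' g -> Ck k U (g \o f).
Proof.
move=> [m [e [l [lc el]]]] oU sU; elim: k g => [|k IH] g.
  move=> cf cg x Ux; apply: continuous_comp; [exact: cf | exact/cg/sU].
move=> Cf [dg Dg]; have [df Df] := Cf; split=> [x Ux|v].
  by apply: differentiable_comp; [exact: df | exact/dg/sU].
have CD i : Ck k U (fun x => (l i ('D_v f x) : R) *: ('D_(e i) g \o f) x).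
  apply: CkZ => //; last exact: (IH _ (CkW Cf) (Dg _)).
  exact: (Ck_comp_linear oU (lc i) (Df v)).
apply: Ck_eq (Ck_sum (index_enum 'I_m) oU CD) => // x; rewrite inE => Ux /=.
rewrite [RHS]deriveE;
  last by apply: differentiable_comp; [exact: df | exact/dg/sU].
rewrite diff_comp /=; [|exact: df|exact/dg/sU].
rewrite -(deriveE v (df x Ux)).
rewrite [in RHS](el ('D_v f x)) linear_sum.
by apply: eq_bigr => i _; rewrite linearZ /= (deriveE (e i) (dg _ (sU _ Ux))).
Qed.

Lemma Ck_pair V W Z k (U : set V) (f : V -> W) (g : V -> Z) :
  open U -> Ck k U f -> Ck k U g -> Ck k U (fun x => (f x, g x)).
Proof.
move=> oU; elim: k f g => [|k IH] f g /=.
  by move=> cf cg x Ux; apply: cvg_pair; [exact: cf | exact: cg].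
move=> [df Df] [dg Dg].
have dfg x : U x -> is_diff x (fun y => (f y, g y))
    (fun v => ('d f x v, 'd g x v)).
  move=> Ux; apply: is_diff_pair; apply: differentiableP; [exact: df | exact: dg].
split=> [x /dfg [] //|v].
apply: Ck_eq (IH _ _ (Df v) (Dg v)) => // x; rewrite inE => Ux /=.
have [dx Ex] := dfg x Ux.
by rewrite [RHS]deriveE // Ex (deriveE v (df x Ux)) (deriveE v (dg x Ux)).
Qed.

Section RowCoord.
Variables (n : nat) (i : 'I_n).
Definition row_coord (v : 'rV[R]_n) : R^o := v 0 i.

Let row_coord_is_linear : linear row_coord.
Proof. by move=> a u v; rewrite /row_coord !mxE. Qed.
HB.instance Definition _ :=
  GRing.isLinear.Build _ _ _ _ row_coord row_coord_is_linear.
End RowCoord.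

Lemma Ck_row_coord V n k (U : set V) (f : V -> 'rV[R]_n) i :
  open U -> Ck k U f -> Ck k U (fun x => f x 0 i : R^o).
Proof.
move=> oU; apply: (@Ck_comp_linear _ _ _ _ _ (row_coord i)) => //.
exact: coord_continuous.
Qed.

Lemma bilinear_form_sum n (b : 'rV[R]_n -> 'rV[R]_n -> R) u v :
  bilinear_form b ->
  b u v = \sum_i u 0 i * \sum_j v 0 j * b (delta_mx 0 i) (delta_mx 0 j).
Proof.
move=> [bl br].
pose B1 w : {scalar 'rV[R]_n} :=
  HB.pack (b^~ w) (GRing.isLinear.Build _ _ _ _ _ (bl w)).
pose B2 w : {scalar 'rV[R]_n} :=
  HB.pack (b w) (GRing.isLinear.Build _ _ _ _ _ (br w)).
rewrite -[LHS]/(B1 v u) [in LHS](row_sum_delta u) linear_sum.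
apply: eq_bigr => i _; rewrite linearZ; congr (_ * _).
rewrite -[LHS]/(B2 (delta_mx 0 i) v) [in LHS](row_sum_delta v) linear_sum.
by apply: eq_bigr => j _; rewrite linearZ.
Qed.

Lemma Ck_bilinear_form V n k (U : set V) (b : 'rV[R]_n -> 'rV[R]_n -> R)
    (f g : V -> 'rV[R]_n) :
  bilinear_form b -> open U -> Ck k U f -> Ck k U g ->
  Ck k U (fun x => b (f x) (g x) : R^o).
Proof.
move=> bb oU Cf Cg; under eq_fun do rewrite bilinear_form_sum //.
apply: Ck_sum => // i; apply: (CkZ oU); first exact: Ck_row_coord.
apply: Ck_sum => // j; apply: (CkZ oU); first exact: Ck_row_coord.
exact: Ck_cst.
Qed.

Lemma finite_frame_rV n : finite_frame 'rV[R]_n.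
Proof.
exists n, (fun i => delta_mx 0 i), (fun i => row_coord i); split=> [i|v].
  exact: coord_continuous.
by rewrite [LHS]row_sum_delta.
Qed.

(** Products of coordinate spaces are the domains of the group law read in charts. *)
Lemma finite_frame_prod V W :
  finite_frame V -> finite_frame W -> finite_frame (V * W)%type.
Proof.
move=> [m [e [l [lc el]]]] [m' [e' [l' [lc' el']]]].
pose E (i : 'I_(m + m')) := match fintype.split i with
  inl j => (e j, 0) | inr j => (0, e' j) end.
pose L (i : 'I_(m + m')) : {linear (V * W)%type -> R^o} :=
  match fintype.split i with inl j => l j \o fst | inr j => l' j \o snd end.
exists (m + m')%N, E, L; split=> [i|[v w]].
  rewrite /L; case: fintype.split => j p; apply: continuous_comp => //=.
  - exact: cvg_fst.
  - exact: lc.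
  - exact: cvg_snd.
  - exact: lc'.
have E1 j : (L (lshift m' j) (v, w) : R) *: E (lshift m' j) =
    ((l j v : R) *: e j, 0).
  by rewrite /L /E (unsplitK (inl j)) /=; congr pair; rewrite scaler0.
have E2 j : (L (rshift m j) (v, w) : R) *: E (rshift m j) =
    (0, (l' j w : R) *: e' j).
  by rewrite /L /E (unsplitK (inr j)) /=; congr pair; rewrite scaler0.
rewrite big_split_ord /= (eq_bigr _ (fun j _ => E1 j)).
rewrite (eq_bigr _ (fun j _ => E2 j)).
rewrite -(big_morph (fun x => (x, 0) : V * W) (id1 := 0) (op1 := +%R)
  (id2 := 0) (op2 := +%R)) //; last first.
  by move=> x y; congr pair; rewrite addr0.
rewrite -(big_morph (fun y => (0, y) : V * W) (id1 := 0) (op1 := +%R)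
  (id2 := 0) (op2 := +%R)) //; last first.
  by move=> x y; congr pair; rewrite addr0.
by rewrite -el -el'; congr pair; rewrite ?addr0 ?add0r.
Qed.

End CkCalculus.

(** * Symmetry of second derivatives *)

Section Schwarz.
Local Open Scope classical_set_scope.
Local Open Scope ring_scope.
Context {R : realType}.
Implicit Types V W : normedModType R.

Lemma is_derive_line V W (f : V -> W) (p v : V) (t : R) :
  differentiable f (p + t *: v) ->
  is_derive t 1 (fun s : R => f (p + s *: v)) ('D_v f (p + t *: v)).
Proof.
move=> df.
have la : is_diff t (fun s : R => p + s *: v) (fun s : R => s *: v).
  apply: (@is_diff_eq _ _ _ _ (fun s : R => 0 + s *: v)).
  by apply/funext => s; rewrite add0r.
have [dc Ec] := @is_diff_comp _ _ _ _ _ _ f _ t la (differentiableP df).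
split; first exact: diff_derivable.
rewrite deriveE //; move: Ec; rewrite /comp => ->.
by rewrite scale1r deriveE.
Qed.

(** Supplies the small parallelogram on which second differences are taken; the parameter ranges are
    closed because its corners are used. *)
Lemma near_plane V (x u v : V) (N : set V) : nbhs x N ->
  exists2 d : R, 0 < d & forall s t, 0 <= s <= d -> 0 <= t <= d ->
    N (x + s *: u + t *: v).
Proof.
move=> Nx.
have c : (fun p : R * R => x + p.1 *: u + p.2 *: v) @ ((0 : R), (0 : R)) --> x.
  rewrite -[X in _ --> X]addr0 -[X in _ --> X + _]addr0.
  rewrite -[X in _ --> _ + X](scale0r v) -[X in _ --> _ + X + _](scale0r u).
  apply: cvgD; [apply: cvgD; first exact: cvg_cst|].
    by apply: cvgZr_tmp; exact: cvg_fst.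
  by apply: cvgZr_tmp; exact: cvg_snd.
have /nbhs_ballP[e /= e0 Be] := c _ Nx.
(* Halving the radius leaves room for closed ranges inside the open ball. *)
exists (e / 2); first by rewrite divr_gt0.
move=> s t /andP[s0 se] /andP[t0 te]; apply: (Be (s, t)).
have e2 : e / 2 < e by rewrite ltr_pdivrMr // ltr_pMr // ltr1n.
by split; rewrite /= /ball /= sub0r normrN ger0_norm // (le_lt_trans _ e2).
Qed.

(** The mean value theorem is used twice: on [t |-> f (x + h u + t v) - f (x + t v)], and then, at
    the [t] so found, on [D_v f] along [u]. *)
Lemma second_difference V (U : set V) (f : V -> R^o) (x u v : V) (h : R) :
  0 < h -> Ck 2 U f ->
  (forall s t, 0 <= s <= h -> 0 <= t <= h -> U (x + s *: u + t *: v)) ->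
  exists2 st, (0 <= st.1 <= h) && (0 <= st.2 <= h) &
  f (x + h *: u + h *: v) - f (x + h *: u) - (f (x + h *: v) - f x)
  = 'D_u ('D_v f) (x + st.1 *: u + st.2 *: v) * h * h.
Proof.
move=> h0 [df /(_ v)[dDf _]] inU.
have [h0' hh] : 0 <= (0 : R) <= h /\ 0 <= h <= h by rewrite !lexx ltW.
have dphi t : 0 <= t <= h -> is_derive t 1
    (fun t : R => f (x + h *: u + t *: v) - f (x + t *: v) : R)
    ('D_v f (x + h *: u + t *: v) - 'D_v f (x + t *: v)).
  move=> t0h; apply: is_deriveB; apply: is_derive_line; apply: df.
    exact: inU.
  by have := inU 0 t h0' t0h; rewrite scale0r addr0.
have [t tI E1] : exists2 t, t \in `]0, h[%R &
    f (x + h *: u + h *: v) - f (x + h *: v) - (f (x + h *: u) - f x) =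
    ('D_v f (x + h *: u + t *: v) - 'D_v f (x + t *: v)) * h.
  have := @MVT R (fun t : R => f (x + h *: u + t *: v) - f (x + t *: v) : R)
    (fun t => 'D_v f (x + h *: u + t *: v) - 'D_v f (x + t *: v)) 0 h h0.
  rewrite !scale0r !addr0 subr0; apply.
    by move=> t; rewrite in_itv /= => /andP[? ?]; apply: dphi; rewrite !ltW.
  apply: derivable_within_continuous => t; rewrite in_itv /= => tI.
  by have [] := dphi t tI.
have tI' : 0 <= t <= h by move: tI; rewrite in_itv /= => /andP[? ?]; rewrite !ltW.
have dpsi s : 0 <= s <= h -> is_derive s 1
    (fun s : R => 'D_v f (x + t *: v + s *: u) : R)
    ('D_u ('D_v f) (x + t *: v + s *: u)).
  move=> s0h; apply: is_derive_line; apply: dDf.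
  by rewrite addrAC; exact: inU.
have [s sI E2] : exists2 s, s \in `]0, h[%R &
    'D_v f (x + t *: v + h *: u) - 'D_v f (x + t *: v) =
    'D_u ('D_v f) (x + t *: v + s *: u) * h.
  have := @MVT R (fun s : R => 'D_v f (x + t *: v + s *: u) : R)
    (fun s => 'D_u ('D_v f) (x + t *: v + s *: u)) 0 h h0.
  rewrite !scale0r !addr0 subr0; apply.
    by move=> s; rewrite in_itv /= => /andP[? ?]; apply: dpsi; rewrite !ltW.
  apply: derivable_within_continuous => s; rewrite in_itv /= => sI.
  by have [] := dpsi s sI.
have sI' : 0 <= s <= h by move: sI; rewrite in_itv /= => /andP[? ?]; rewrite !ltW.
exists (s, t) => /=; first by rewrite sI' tI'.
rewrite [x + s *: u + _]addrAC -E2 [x + t *: v + _]addrAC -E1.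
rewrite !opprB !addrA [LHS]addrAC [in RHS]addrAC.
by congr (_ + _); rewrite addrAC.
Qed.

(** The second difference is symmetric in [u] and [v], so a value of [D_u D_v f] equals a value of
    [D_v D_u f] at another point of the same small parallelogram. Both are within [e / 2] of their
    values at [x] by continuity. *)
Lemma schwarz V (U : set V) (f : V -> R^o) (x u v : V) :
  open U -> U x -> Ck 2 U f -> 'D_u ('D_v f) x = 'D_v ('D_u f) x.
Proof.
move=> oU Ux Cf; apply/eqP; rewrite -subr_eq0 -normr_eq0 eq_le normr_ge0 andbT.
apply/ler_addgt0Pl => e e0; rewrite addr0.
have e2 : 0 < e / 2 by rewrite divr_gt0.
have close (a b : V) : \forall y \near x,
    `|'D_a ('D_b f) x - 'D_a ('D_b f) y| < e / 2.
  have [_ /(_ b)[_ /(_ a) c]] := Cf.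
  by have /cvgrPdist_lt := c x Ux; apply.
have NU := open_nbhs_nbhs (conj oU Ux).
have [d d0 inN] := near_plane u v (filterI NU (filterI (close u v) (close v u))).
have [[s t] /= /andP[sI tI] E1] := second_difference d0 Cf
  (fun s t sI tI => (inN s t sI tI).1).
have inN' a b : 0 <= a <= d -> 0 <= b <= d -> U (x + a *: v + b *: u).
  by move=> aI bI; rewrite addrAC; have [] := inN b a bI aI.
have [[s' t'] /= /andP[sI' tI'] E2] := second_difference d0 Cf inN'.
(* Cancels the side length [d], nonzero, twice once the two second differences are identified. *)
have key (a b Da Db : R) : Da = a * d * d -> Db = b * d * d -> Da = Db -> a = b.
  move=> -> -> E; apply: (mulIf (lt0r_neq0 d0)).
  exact: (mulIf (lt0r_neq0 d0)).
have E := key _ _ _ _ E1 E2; rewrite [x + s' *: v + _]addrAC in E.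
rewrite [x + d *: v + _]addrAC in E.
have {}E : 'D_u ('D_v f) (x + s *: u + t *: v) =
    'D_v ('D_u f) (x + t' *: u + s' *: v).
  apply: E; move: (f _) (f _) (f _) (f _) => a b c e'.
  by rewrite !opprB addrACA [RHS]addrACA [- c + _]addrC.
have [_ [c1 _]] := inN s t sI tI; have [_ [_ c2]] := inN t' s' tI' sI'.
rewrite -(subrKA ('D_u ('D_v f) (x + s *: u + t *: v))).
apply: (le_trans (ler_normD _ _)); rewrite (splitr e); apply/ltW/ltrD.
  exact: c1.
by rewrite E distrC.
Qed.

Lemma schwarz_rV V n (U : set V) (f : V -> 'rV[R]_n) (x u v : V) :
  open U -> U x -> Ck 2 U f -> 'D_u ('D_v f) x = 'D_v ('D_u f) x.
Proof.
move=> oU Ux Cf; have [m [e [l [lc el]]]] := @finite_frame_rV R n.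
have linj w w' : (forall i, l i w = l i w') -> w = w'.
  by move=> E; rewrite (el w) (el w'); apply: eq_bigr => i _; rewrite E.
apply: linj => i.
have [df Df] := Cf.
have D2 a b : l i ('D_a ('D_b f) x) = 'D_a ('D_b (l i \o f)) x.
  have [dDf _] := Df b.
  rewrite -derive_comp_linear //; last exact: dDf.
  apply: near_eq_derive; have := open_nbhs_nbhs (conj oU Ux).
  by apply: filterS => y Uy; rewrite /= derive_comp_linear //; exact: df.
have S := schwarz u v oU Ux (Ck_comp_linear oU (lc i) Cf).
exact: etrans (D2 u v) (etrans S (esym (D2 v u))).
Qed.

(** The product rule for a differential applied to a moving vector. Expanding the vector in the
    frame reduces it to products of scalar functions with the derivatives ['D_(e i) f]. *)
Lemma derive_diff_apply V W (U : set V) (f : V -> W) (eta : V -> V) (p u : V) :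
  finite_frame V -> open U -> U p -> Ck 2 U f -> differentiable eta p ->
  'D_u (fun q => 'd f q (eta q)) p = 'D_u ('D_(eta p) f) p + 'd f p ('D_u eta p).
Proof.
move=> [m [e [l [lc el]]]] oU Up Cf.
have [df Df] := Cf; have nU : nbhs p U by exact: open_nbhs_nbhs.
have expand (xi : V -> V) : differentiable xi p ->
    'D_u (fun q => 'd f q (xi q)) p =
    \sum_i ((l i (xi p) : R) *: 'D_u ('D_(e i) f) p) + 'd f p ('D_u xi p).
  move=> dxi.
  pose h i q := (l i (xi q) : R) *: 'D_(e i) f q.
  have dh i : is_derive p u (h i) ((l i (xi p) : R) *: 'D_u ('D_(e i) f) p +
      (l i ('D_u xi p) : R) *: 'D_(e i) f p).
    have [dDf _] := Df (e i).
    have dl := linear_differentiable (xi p) (lc i).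
    have dlxi := differentiable_comp dxi dl.
    have [dhi Eh] := is_diff_scale (differentiableP dlxi)
      (differentiableP (dDf p Up)).
    split; first exact: diff_derivable.
    rewrite deriveE // Eh -(deriveE u (dDf p Up)) -(deriveE u dlxi).
    by rewrite (derive_comp_linear u (lc i) dxi).
  have -> : 'D_u (fun q => 'd f q (xi q)) p = 'D_u (\sum_i h i) p.
    apply: near_eq_derive; apply: filterS nU => q Uq.
    rewrite fct_sumE {1}(el (xi q)) linear_sum; apply: eq_bigr => i _.
    by rewrite linearZZ /h (deriveE (e i) (df q Uq)).
  have [_ ->] := is_derive_sum dh; rewrite big_split /=; congr (_ + _).
  rewrite {2}(el ('D_u xi p)) linear_sum; apply: eq_bigr => i _.
  by rewrite linearZZ (deriveE (e i) (df p Up)).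
move=> deta; rewrite (expand _ deta); congr (_ + _).
(* The remaining sum involves the field only through its value at [p]; evaluating it on the constant
   field identifies it as an iterated derivative. *)
have := expand (cst (eta p)) (differentiable_cst _ _).
rewrite derive_cst linear0 addr0 => <-.
apply: near_eq_derive; apply: filterS nU => q Uq.
by rewrite (deriveE _ (df q Uq)).
Qed.

(** Lets the differential of a translation be read as a partial derivative of the group law, which
    is jointly smooth. *)
Lemma derive_pair_snd (V V' W : normedModType R) (m : V * V' -> W) p q (v : V') :
  differentiable m (p, q) ->
  'D_v (fun q => m (p, q)) q = 'D_((0, v) : V * V') m (p, q).
Proof.
move=> dm; have dp : is_diff q (fun q : V' => (p, q)) (fun v => (0 : V, v)).
  by apply: is_diff_pair.
have [dmp E] := is_diff_comp dp (differentiableP dm).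
by rewrite (deriveE _ dm); apply: etrans (deriveE _ dmp) _; rewrite E.
Qed.

End Schwarz.

(** * Smooth maps of manifolds and brackets *)

Section SmoothMaps.
Local Open Scope classical_set_scope.
Local Open Scope ring_scope.
Context {R : realType} {n : nat} {M : topologicalType}.
Variable A : manifold R n M.
Implicit Types (phi psi chi : chart R n M) (F : M -> M).
#[local] Opaque diff derive.

(** Up to conversion, [coord] and [of_coord] are differentials of [rep] at the identity map, and
    [tangent_map] is one between preferred charts. A single chain rule thus serves all three. *)
Definition rep phi psi F : 'rV[R]_n -> 'rV[R]_n := psi \o F \o cinv phi.

Definition rep_dom phi psi F : set 'rV[R]_n :=
  [set p | cran phi p /\ cdom psi (F (cinv phi p))].

Definition smooth_map F := continuous F /\
  forall phi psi, atlas A phi -> atlas A psi ->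
    smooth_on (rep_dom phi psi F) (rep phi psi F).

Lemma cran_dom phi x : cdom phi x -> cran phi (phi x).
Proof. by exists x. Qed.

Lemma cdom_cinv phi p : cran phi p -> cdom phi (cinv phi p).
Proof. by move=> [x dx <-]; rewrite cfunK. Qed.

Lemma cinvK phi p : cran phi p -> phi (cinv phi p) = p.
Proof. by move=> [x dx <-]; rewrite cfunK. Qed.

Lemma open_cran phi : open (cran phi). Proof. exact: cran_open. Qed.

Lemma open_cinv_preimage phi (T : topologicalType) (F : M -> T) (B : set T) :
  continuous F -> open B -> open [set p | cran phi p /\ B (F (cinv phi p))].
Proof.
move=> cF oB; rewrite openE => p [rp dp]; apply: (@filterI _ (nbhs p)).
  by apply: open_nbhs_nbhs; split=> //; exact: open_cran.
have c : {for p, continuous (F \o cinv phi)}.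
  by apply: continuous_comp; [exact: cinv_cont rp | exact: cF].
by apply: c; apply: open_nbhs_nbhs.
Qed.

Lemma open_rep_dom phi psi F : continuous F -> open (rep_dom phi psi F).
Proof. by move=> cF; apply: open_cinv_preimage => //; exact: cdom_open. Qed.

Lemma rep_dom_cfun phi psi F x :
  cdom phi x -> cdom psi (F x) -> rep_dom phi psi F (phi x).
Proof. by move=> dx dFx; split; [exact: cran_dom | rewrite cfunK]. Qed.

Lemma smooth_map_id : smooth_map id.
Proof. by split=> [x|]; [exact: cvg_id | exact: atlas_smooth]. Qed.

Lemma differentiable_rep phi psi F x : smooth_map F -> atlas A phi ->
  atlas A psi -> cdom phi x -> cdom psi (F x) ->
  differentiable (rep phi psi F) (phi x).
Proof.
move=> [cF sF] aphi apsi dx dFx.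
by have [df _] := sF _ _ aphi apsi 1%N; apply: df; exact: rep_dom_cfun.
Qed.

(** Near [phi x] the intermediate chart [psi] cancels, and the ordinary chain rule applies. Taking
    [F] or [F'] to be the identity yields the changes of coordinates below. *)
Lemma diff_rep_comp phi psi chi F F' x v :
  smooth_map F -> smooth_map F' ->
  atlas A phi -> atlas A psi -> atlas A chi ->
  cdom phi x -> cdom psi (F x) -> cdom chi (F' (F x)) ->
  'd (rep psi chi F') (psi (F x)) ('d (rep phi psi F) (phi x) v)
  = 'd (rep phi chi (F' \o F)) (phi x) v.
Proof.
move=> sF sF' aphi apsi achi dx dFx dFFx.
have dF := differentiable_rep sF aphi apsi dx dFx.
have dF' := differentiable_rep sF' apsi achi dFx dFFx.
have E : psi (F x) = rep phi psi F (phi x) by rewrite /rep /= cfunK.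
move: dF'; rewrite E => dF'.
have N : \forall p \near phi x, (rep psi chi F' \o rep phi psi F) p
    = rep phi chi (F' \o F) p.
  have : nbhs (phi x) (rep_dom phi psi F).
    apply: open_nbhs_nbhs; split; last exact: rep_dom_cfun.
    exact: open_rep_dom sF.1.
  by apply: filterS => p [rp dp]; rewrite /rep /= cfunK.
have e1 := congr1 (@^~ v) (near_eq_diff N (differentiable_comp dF dF')).
have e2 := congr1 (@^~ v) (diff_comp dF dF').
move: e1 e2 => /= e1 e2.
refine (etrans (esym e2) _).
refine (etrans (esym e1) _).
reflexivity.
Qed.

Lemma diff_rep_id phi x v : atlas A phi -> cdom phi x ->
  'd (rep phi phi id) (phi x) v = v.
Proof.
move=> aphi dx; rewrite (@near_eq_diff _ _ _ id) ?diff_val //.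
have := open_nbhs_nbhs (conj (@open_cran phi) (cran_dom dx)).
by apply: filterS => p rp; rewrite /rep /= cinvK.
Qed.

Let atA := chart_at_atlas A.
Let domA := chart_at_dom A.

Lemma coordK phi x v : atlas A phi -> cdom phi x ->
  of_coord A phi x (Defs.coord A phi x v) = v.
Proof.
move=> aphi dx; have I := smooth_map_id.
apply: etrans (diff_rep_id v (atA x) (domA x)).
exact: (diff_rep_comp v I I (atA x) aphi (atA x) (domA x) dx (domA x)).
Qed.

Lemma coord_chart_at x v : Defs.coord A (chart_at A x) x v = v.
Proof. exact: diff_rep_id. Qed.

Lemma tangent_map_id x v : tangent_map A id x v = v.
Proof. exact: diff_rep_id. Qed.

Lemma tangent_map_comp F F' x v : smooth_map F -> smooth_map F' ->
  tangent_map A (F' \o F) x v = tangent_map A F' (F x) (tangent_map A F x v).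
Proof.
move=> sF sF'; apply: esym.
exact: (diff_rep_comp v sF sF' (atA _) (atA _) (atA _)).
Qed.

Lemma coord_tangent_map psi F x v : smooth_map F -> atlas A psi ->
  cdom psi (F x) -> Defs.coord A psi (F x) (tangent_map A F x v)
  = 'd (rep (chart_at A x) psi F) (chart_at A x x) v.
Proof.
move=> sF apsi dFx.
exact: (diff_rep_comp v sF smooth_map_id (atA _) (atA _) apsi).
Qed.

Lemma diff_rep_coord phi psi F x v : smooth_map F ->
  atlas A phi -> atlas A psi -> cdom phi x -> cdom psi (F x) ->
  'd (rep phi psi F) (phi x) (Defs.coord A phi x v)
  = Defs.coord A psi (F x) (tangent_map A F x v).
Proof.
move=> sF aphi apsi dx dFx.
apply: etrans (esym (coord_tangent_map v sF apsi dFx)).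
exact: (diff_rep_comp v smooth_map_id sF (atA _) aphi apsi (domA x)).
Qed.

Lemma tangent_map_of_coord phi F x v : smooth_map F -> atlas A phi ->
  cdom phi x -> tangent_map A F x (of_coord A phi x v)
  = 'd (rep phi (chart_at A (F x)) F) (phi x) v.
Proof.
move=> sF aphi dx.
exact: (diff_rep_comp v smooth_map_id sF aphi (atA x) (atA (F x)) dx).
Qed.

(** * Smooth vector fields and their brackets *)

Lemma differentiable_local_rep phi (X : vfield) x : smooth_vf A X ->
  atlas A phi -> cdom phi x -> differentiable (local_rep A phi X) (phi x).
Proof. by move=> sX aphi dx; have [df _] := sX _ aphi 1%N; exact/df/cran_dom. Qed.

Lemma local_rep_chart_at (X : vfield) x :
  local_rep A (chart_at A x) X (chart_at A x x) = X x.
Proof. by rewrite /local_rep cfunK // coord_chart_at. Qed.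

Lemma local_rep_linear phi (X Y : vfield) a :
  local_rep A phi (fun x => a *: X x + Y x)
  = a *: local_rep A phi X + local_rep A phi Y.
Proof. by apply/funext => p; exact: (linearP ('d _ _)). Qed.

Lemma smooth_vf_linear (X Y : vfield) a : smooth_vf A X -> smooth_vf A Y ->
  smooth_vf A (fun x => a *: X x + Y x).
Proof.
move=> sX sY phi aphi k; rewrite local_rep_linear.
have o := @open_cran phi.
apply: (CkD o _ (sY _ aphi k)).
exact: (CkZ (a := cst a) o (Ck_cst k _ (a : R^o)) (sX _ aphi k)).
Qed.

Lemma smooth_vfZ (f : M -> R) (X : vfield) : smooth_fun A f -> smooth_vf A X ->
  smooth_vf A (fun x => f x *: X x).
Proof.
move=> sf sX phi aphi k; have o := @open_cran phi.
have -> : local_rep A phi (fun x => f x *: X x) =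
    (fun p => f (cinv phi p) *: local_rep A phi X p).
  by apply/funext => p; exact: (linearZZ ('d _ _)).
exact: (CkZ o (sf _ aphi k) (sX _ aphi k)).
Qed.

Lemma smooth_vf0 : smooth_vf A (fun=> 0).
Proof.
move=> phi aphi k; have -> : local_rep A phi (fun=> 0) = cst 0.
  by apply/funext => p; exact: (linear0 ('d _ _)).
exact: Ck_cst.
Qed.

Lemma smooth_fun_cst (a : R) : smooth_fun A (fun=> a).
Proof. by move=> phi aphi k; exact: Ck_cst. Qed.

Lemma smooth_vf_sum (I : Type) (r : seq I) (f : I -> M -> R)
    (X : I -> vfield) :
  (forall i, smooth_fun A (f i)) -> (forall i, smooth_vf A (X i)) ->
  smooth_vf A (fun x => \sum_(i <- r) f i x *: X i x).
Proof.
move=> sf sX; elim: r => [|i r IH].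
  by under eq_fun do rewrite big_nil; exact: smooth_vf0.
under eq_fun do rewrite big_cons -[f i _ *: _]scale1r.
by apply: smooth_vf_linear => //; exact: smooth_vfZ.
Qed.

Lemma bracket_linearr (X Y Z : vfield) a x :
  smooth_vf A X -> smooth_vf A Y -> smooth_vf A Z ->
  bracket A X (fun y => a *: Y y + Z y) x
  = a *: bracket A X Y x + bracket A X Z x.
Proof.
move=> sX sY sZ; rewrite /bracket local_rep_linear.
have dX := differentiable_local_rep sX (atA x) (domA x).
have dY := differentiable_local_rep sY (atA x) (domA x).
have dZ := differentiable_local_rep sZ (atA x) (domA x).
rewrite deriveD;
  [|by apply: derivableZ; exact: diff_derivable|exact: diff_derivable].
rewrite deriveZ; last exact: diff_derivable.
rewrite !(deriveE _ dX) linearP scalerBr opprD.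
exact: addrACA.
Qed.

Lemma bracketC (X Y : vfield) x : bracket A X Y x = - bracket A Y X x.
Proof. by rewrite /bracket opprB. Qed.

Lemma bracket_linearl (X Y Z : vfield) a x :
  smooth_vf A X -> smooth_vf A Y -> smooth_vf A Z ->
  bracket A (fun y => a *: X y + Y y) Z x
  = a *: bracket A X Z x + bracket A Y Z x.
Proof.
move=> sX sY sZ; rewrite bracketC (bracket_linearr a x sZ sX sY).
by rewrite (bracketC X Z) (bracketC Y Z) opprD scalerN.
Qed.

(** In charts, with [f] representing [F], relatedness reads [Y (f p) = 'd f p (Y p)].
    Differentiating along [X] gives [D_X D_Y f + 'd f (D_X Y)]; in the bracket the second
    derivatives of [f] cancel by symmetry. *)
Lemma bracket_push F (X Y : vfield) x : smooth_map F ->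
  smooth_vf A X -> smooth_vf A Y ->
  (forall y, X (F y) = tangent_map A F y (X y)) ->
  (forall y, Y (F y) = tangent_map A F y (Y y)) ->
  bracket A X Y (F x) = tangent_map A F x (bracket A X Y x).
Proof.
move=> sF sX sY XF YF.
set phi := chart_at A x; set psi := chart_at A (F x).
have dx : cdom phi x by exact: domA.
have dFx : cdom psi (F x) by exact: domA.
have aphi : atlas A phi by exact: atA.
have apsi : atlas A psi by exact: atA.
pose U := rep_dom phi psi F; pose f := rep phi psi F.
have oU : open U by exact/open_rep_dom/sF.1.
have Ux : U (phi x) by exact: rep_dom_cfun.
have Sf : smooth_on U f by exact: (sF.2 _ _ aphi apsi).
have fx : f (phi x) = psi (F x) by rewrite /f /rep /= cfunK.
have push (Z : vfield) : (forall y, Z (F y) = tangent_map A F y (Z y)) ->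
    forall p, U p -> local_rep A psi Z (f p) = 'd f p (local_rep A phi Z p).
  move=> ZF p [rp dp]; rewrite /local_rep.
  have -> : cinv psi (f p) = F (cinv phi p) by exact: cfunK.
  have dy := cdom_cinv rp.
  rewrite ZF; apply: etrans (esym (diff_rep_coord _ sF aphi apsi dy dp)) _.
  by rewrite cinvK.
have dirderiv (Z W : vfield) : smooth_vf A Z -> smooth_vf A W ->
    (forall y, Z (F y) = tangent_map A F y (Z y)) ->
    (forall y, W (F y) = tangent_map A F y (W y)) ->
    'D_(Z (F x)) (local_rep A psi W) (psi (F x)) =
    'D_(Z x) ('D_(W x) f) (phi x) +
    'd f (phi x) ('D_(Z x) (local_rep A phi W) (phi x)).
  move=> sZ sW ZF WF.
  have dW := differentiable_local_rep sW aphi dx.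
  have dW' := differentiable_local_rep sW apsi dFx.
  have df : differentiable f (phi x) by exact: (Sf 1%N).1.
  have -> : W x = local_rep A phi W (phi x) by rewrite local_rep_chart_at.
  apply: etrans (derive_diff_apply _ (finite_frame_rV _) oU Ux (Sf 2) dW).
  rewrite (deriveE _ dW') ZF; move: dW'; rewrite -/psi -fx => dW'.
  have e2 := congr1 (@^~ (Z x)) (diff_comp df dW').
  apply: etrans (esym e2) _.
  apply: etrans (esym (deriveE (Z x) (differentiable_comp df dW'))) _.
  apply: near_eq_derive; have : nbhs (phi x) U by exact: open_nbhs_nbhs.
  by apply: filterS => p Up; exact: push.
rewrite {1}/bracket -/psi (dirderiv X Y) // (dirderiv Y X) //.
rewrite (schwarz_rV _ _ oU Ux (Sf 2)) opprD addrACA subrr add0r.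
by rewrite /tangent_map /bracket linearB.
Qed.

End SmoothMaps.

(** * Left-invariant fields and the Killing form *)

Section LieGroups.
Local Open Scope classical_set_scope.
Local Open Scope ring_scope.
Context {R : realType} {n : nat} {G : topologicalGroupCarrierType}.
Variable L : lie_group R n G.
#[local] Opaque diff derive.
Implicit Types (phi psi chi : chart R n G) (X Y Z : @vfield R n G).
Implicit Types (x y z : G) (u v w : 'rV[R]_n).

Local Notation lmul z := (fun y : G => (z * y)%g).
Local Notation left_ext := (left_ext L).
Local Notation bracket := (bracket L).
Local Notation killing := (killing L).

Let atL := chart_at_atlas L.
Let domL := chart_at_dom L.

Definition mul_rep phi psi chi (pq : 'rV[R]_n * 'rV[R]_n) : 'rV[R]_n :=
  chi (cinv phi pq.1 * cinv psi pq.2)%g.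

(** In charts, left translation is the group law restricted to the slice where the first coordinate
    is that of [z]. *)
Lemma smooth_map_lmul z : smooth_map L (lmul z).
Proof.
have cz : continuous (lmul z).
  move=> y; apply: (@continuous_comp _ _ _ (fun y => (z, y))
    (fun p : G * G => (p.1 * p.2)%g)); last exact: (lie_mul_cont L).
  by apply: cvg_pair; [exact: cvg_cst | exact: cvg_id].
split=> // psi chi apsi achi k.
pose phi := chart_at L z; have zz : cinv phi (phi z) = z by exact/cfunK/domL.
have oU := @open_rep_dom _ _ _ psi chi _ cz.
have -> : rep psi chi (lmul z) = mul_rep phi psi chi \o (fun p => (phi z, p)).
  by apply/funext => p; rewrite /rep /mul_rep /= zz.
apply: (Ck_comp (finite_frame_prod (@finite_frame_rV R n) (@finite_frame_rV R n))
  oU) (lie_mul_smooth (atL z) apsi achi k).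
  by move=> p [rp dp]; split=> //=; [exact/cran_dom/domL | rewrite zz].
apply: Ck_pair => //; first exact: Ck_cst.
exact: Ck_id.
Qed.

Lemma left_ext_self x v : left_ext x v x = v.
Proof.
rewrite /Defs.left_ext mulgV; have -> : lmul 1 = id.
  by apply/funext => y; rewrite mul1g.
exact: tangent_map_id.
Qed.

Lemma left_ext_left_invariant x v : left_invariant L (left_ext x v).
Proof.
move=> z y; rewrite /Defs.left_ext.
have -> : (fun w : G => z * y * x^-1 * w)%g = lmul z \o lmul (y * x^-1)%g.
  by apply/funext => w /=; rewrite !mulgA.
rewrite tangent_map_comp; [|exact: smooth_map_lmul..].
by rewrite -mulgA mulVg mulg1.
Qed.

Lemma left_invariant_ext x X : left_invariant L X -> left_ext x (X x) = X.
Proof.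
by move=> iX; apply/funext => y; rewrite /Defs.left_ext -iX -mulgA mulVg mulg1.
Qed.

Lemma left_ext_linear x a u v :
  left_ext x (a *: u + v) = (fun y => a *: left_ext x u y + left_ext x v y).
Proof. by apply/funext => y; exact: (linearP ('d _ _)). Qed.

Lemma left_ext_trans x y v : left_ext y (left_ext x v y) = left_ext x v.
Proof. exact/left_invariant_ext/left_ext_left_invariant. Qed.

Lemma left_ext_tangent z x v :
  left_ext (z * x)%g (tangent_map L (lmul z) x v) = left_ext x v.
Proof.
by rewrite -[X in tangent_map L _ _ X](left_ext_self x v)
  -left_ext_left_invariant left_ext_trans.
Qed.

(** At [p] the local representative is the derivative of the group law at [(p, c1 1)] in the
    direction [(0, v)]. One derivative is spent, so class [C^k] comes from class [C^(k+1)] of the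
    law. *)
Lemma smooth_left_ext v : smooth_vf L (left_ext 1%g v).
Proof.
move=> phi aphi k; pose c1 := chart_at L (1%g : G).
have d1 : cdom c1 1%g by exact: domL.
have c11 : cinv c1 (c1 1%g) = 1%g by exact: cfunK.
have Sm := lie_mul_smooth aphi (atL 1%g) aphi.
have dom p : cran phi p -> [/\ cran phi p, cran c1 (c1 1%g) &
    cdom phi (cinv phi p * cinv c1 (c1 1%g))%g].
  move=> rp; split=> //; first exact: cran_dom.
  by rewrite c11 mulg1; exact: cdom_cinv.
have oU := @open_cran _ _ _ phi.
apply: (@Ck_eq _ _ _ _ _
  ('D_((0, v) : 'rV[R]_n * 'rV[R]_n) (mul_rep phi c1 phi)
    \o (fun p => (p, c1 1%g)))) => //.
  move=> p; rewrite inE => rp; have [dm _] := Sm 1%N.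
  have dmp := dm (p, c1 1%g) (dom p rp).
  apply: etrans (esym (derive_pair_snd v dmp)) _.
  rewrite /local_rep /Defs.left_ext invg1 mulg1.
  have dy : cdom phi (cinv phi p * 1)%g by rewrite mulg1; exact: cdom_cinv.
  have := coord_tangent_map v (smooth_map_lmul (cinv phi p)) aphi dy.
  rewrite mulg1 => ->; apply: deriveE.
  exact: (differentiable_rep (smooth_map_lmul _) (atL _) aphi d1 dy).
apply: (Ck_comp (finite_frame_prod (@finite_frame_rV R n) (@finite_frame_rV R n))
  oU dom); last exact: (Sm k.+1).2.
apply: Ck_pair => //; last exact: Ck_cst.
exact: Ck_id.
Qed.

Lemma left_invariant_smooth X : left_invariant L X -> smooth_vf L X.
Proof. by move=> /(left_invariant_ext 1%g) <-; exact: smooth_left_ext. Qed.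

Lemma bracket_left_invariant X Y : left_invariant L X -> left_invariant L Y ->
  left_invariant L (bracket X Y).
Proof.
move=> iX iY z x; apply: (bracket_push x (smooth_map_lmul z)).
- exact: left_invariant_smooth.
- exact: left_invariant_smooth.
- by move=> y; exact: iX.
- by move=> y; exact: iY.
Qed.

(** * The adjoint action and its trace form *)

Definition ad_mx X : 'M[R]_n :=
  lin1_mx (fun v => bracket X (left_ext 1%g v) 1%g).

Lemma ad_mxE X v : left_invariant L X ->
  v *m ad_mx X = bracket X (left_ext 1%g v) 1%g.
Proof.
move=> iX; pose f v := bracket X (left_ext 1%g v) 1%g.
have fl : linear f.
  move=> a u w; rewrite /f left_ext_linear bracket_linearr //.
  - exact: left_invariant_smooth.
  - exact: smooth_left_ext.
  - exact: smooth_left_ext.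
pose F : {linear 'rV[R]_n -> 'rV[R]_n} :=
  HB.pack f (GRing.isLinear.Build _ _ _ _ _ fl).
exact: (mul_rV_lin1 F).
Qed.

Lemma left_ext_bracket X v : left_invariant L X ->
  bracket X (left_ext 1%g v) = left_ext 1%g (v *m ad_mx X).
Proof.
move=> iX; rewrite ad_mxE //; apply/esym/left_invariant_ext.
exact/bracket_left_invariant/left_ext_left_invariant.
Qed.

(** Matrices act on row vectors from the right, hence the reversed order of the product. *)
Lemma killingE X Y : left_invariant L X -> left_invariant L Y ->
  killing X Y = \tr (ad_mx Y *m ad_mx X).
Proof.
move=> iX iY; rewrite /Defs.killing; congr (\tr _).
have -> : (fun v => bracket X (bracket Y (left_ext 1%g v)) 1%g) =
    mulmxr (ad_mx Y *m ad_mx X).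
  by apply/funext => v; rewrite left_ext_bracket // -ad_mxE //= mulmxA.
by apply/row_matrixP => i; rewrite !rowE mul_rV_lin1.
Qed.

#[local] Opaque ad_mx Defs.killing Defs.bracket Defs.left_ext.

Lemma killingC X Y : left_invariant L X -> left_invariant L Y ->
  killing X Y = killing Y X.
Proof.
move=> iX iY; rewrite (killingE iX iY) (killingE iY iX).
exact: mxtrace_mulC.
Qed.

Lemma left_invariant_linear X Y a : left_invariant L X -> left_invariant L Y ->
  left_invariant L (fun x => a *: X x + Y x).
Proof. by move=> iX iY z x; rewrite iX iY; apply/esym/(linearP ('d _ _)). Qed.

Lemma ad_mx_linear X Y a : left_invariant L X -> left_invariant L Y ->
  ad_mx (fun x => a *: X x + Y x) = a *: ad_mx X + ad_mx Y.
Proof.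
move=> iX iY; apply/row_matrixP => i; rewrite !rowE mulmxDr -scalemxAr.
apply: etrans (ad_mxE _ (left_invariant_linear a iX iY)) _.
apply: etrans (bracket_linearl a 1%g (left_invariant_smooth iX)
  (left_invariant_smooth iY) (smooth_left_ext _)) _.
by congr (_ *: _ + _); apply/esym/ad_mxE.
Qed.

Lemma killing_linearr X Y Z a : left_invariant L X -> left_invariant L Y ->
  left_invariant L Z ->
  killing Z (fun x => a *: X x + Y x) = a * killing Z X + killing Z Y.
Proof.
move=> iX iY iZ; rewrite (killingE iZ iX) (killingE iZ iY).
apply: etrans (killingE iZ (left_invariant_linear a iX iY)) _.
by rewrite (ad_mx_linear a iX iY) mulmxDl mxtraceD -scalemxAl mxtraceZ.
Qed.

(** The two families [f] and [g] are kept apart so that vectors may be extended from two different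
    base points. Linearity on the left follows from symmetry. *)
Lemma bilinear_form_killing (f g : 'rV[R]_n -> @vfield R n G) :
  (forall v, left_invariant L (f v)) -> (forall v, left_invariant L (g v)) ->
  (forall a u v, f (a *: u + v) = (fun x => a *: f u x + f v x)) ->
  (forall a u v, g (a *: u + v) = (fun x => a *: g u x + g v x)) ->
  bilinear_form (fun u v => killing (f u) (g v)).
Proof.
move=> iF iG fP gP; split=> [w|v] a u u'.
  rewrite (killingC (iF _) (iG w)) (killingC (iF u) (iG w)).
  by rewrite (killingC (iF u') (iG w)) fP; exact: killing_linearr.
by rewrite gP; exact: killing_linearr.
Qed.

End LieGroups.

(** * The Maurer-Cartan form *)

Section MaurerCartan.
Local Open Scope classical_set_scope.
Local Open Scope ring_scope.
Context {R : realType} {n : nat} {G : topologicalGroupCarrierType}.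
Variable L : lie_group R n G.
#[local] Opaque diff derive Defs.bracket Defs.killing.
Implicit Types (phi psi : chart R n G) (X Y Z : @vfield R n G).
Implicit Types (x y z : G) (u v w : 'rV[R]_n).

Local Notation lmul z := (fun y : G => (z * y)%g).
Local Notation left_ext := (left_ext L).
Local Notation left_frame := (left_frame L).

Let atL := chart_at_atlas L.
Let domL := chart_at_dom L.

Lemma left_ext_sum (I : Type) (r : seq I) (a : I -> R) (v : I -> 'rV[R]_n) x y :
  left_ext x (\sum_(i <- r) a i *: v i) y
  = \sum_(i <- r) a i *: left_ext x (v i) y.
Proof.
apply: etrans (linear_sum ('d _ _) _ _ _) _.
by apply: eq_bigr => i _; exact: (linearZZ ('d _ _)).
Qed.

Lemma left_ext0 x y : left_ext x 0 y = 0.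
Proof. exact: (linear0 ('d _ _)). Qed.

Lemma left_frame_sum (a : 'I_n -> R) y :
  \sum_i a i *: left_frame i y = left_ext 1%g (\row_i a i) y.
Proof.
rewrite [X in left_ext _ X](row_sum_delta (\row_i a i)) left_ext_sum.
by apply: eq_bigr => i _; rewrite mxE.
Qed.

Lemma left_ext_inj x y v : left_ext x v y = 0 -> v = 0.
Proof.
move=> E.
by rewrite -(left_ext_self L x v) -(left_ext_trans L x y) E left_ext0.
Qed.

(** The [i]-th component of the Maurer-Cartan form on [X x], that is, of [X x] translated back to
    the identity. *)
Definition frame_coef X i x : R := left_ext x (X x) 1%g 0 i.

Lemma frame_decomposition X x :
  X x = \sum_i frame_coef X i x *: left_frame i x.
Proof.
rewrite left_frame_sum; have -> : \row_i frame_coef X i x = left_ext x (X x) 1%g.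
  by apply/rowP => i; rewrite mxE.
by rewrite left_ext_trans left_ext_self.
Qed.

Lemma left_frame_left_invariant i : left_invariant L (left_frame i).
Proof. exact: left_ext_left_invariant. Qed.

Lemma smooth_left_frame i : smooth_vf L (left_frame i).
Proof. exact: smooth_left_ext. Qed.

Lemma left_ext_of_coord phi x v : atlas L phi -> cdom phi x ->
  left_ext x (of_coord L phi x v) 1%g
  = 'd (rep phi (chart_at L (1%g : G)) (lmul x^-1%g)) (phi x) v.
Proof.
move=> aphi dx; have := tangent_map_of_coord v (smooth_map_lmul L x^-1%g) aphi dx.
by rewrite mulVg => <-; rewrite /Defs.left_ext mul1g.
Qed.

#[local] Opaque Defs.left_ext.

(** With [x] the point of coordinates [p], the form at [x] is the partial derivative of
    [(a, q) |-> a * q] in [q], at [a = x^-1]. Near [p0] the inverse stays in the single chart [psi],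
    so locally the form is a derivative of the group law composed with [p |-> (J p, p)]. *)
Lemma smooth_maurer_cartan phi v : atlas L phi ->
  smooth_on (cran phi)
    (fun p => left_ext (cinv phi p) (of_coord L phi (cinv phi p) v) 1%g).
Proof.
move=> aphi k; apply: Ck_local => p0 rp0.
pose c1 := chart_at L (1%g : G); pose psi := chart_at L (cinv phi p0)^-1%g.
pose U := [set p | cran phi p /\ cdom psi (cinv phi p)^-1%g].
have oU : open U.
  apply: (@open_cinv_preimage _ _ _ phi _ (fun x => x^-1%g)).
    exact: lie_inv_cont L.
  exact: cdom_open.
exists U; first by split=> //; exact: domL.
pose J p := psi (cinv phi p)^-1%g.
have SJ : Ck k U J by exact: (lie_inv_smooth aphi (atL _)).
have Sm := lie_mul_smooth (atL (cinv phi p0)^-1%g) aphi (atL 1%g).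
have dom p : U p -> [/\ cran psi (J p), cran phi p &
    cdom c1 (cinv psi (J p) * cinv phi p)%g].
  move=> [rp dp]; split=> //; first exact: cran_dom.
  by rewrite cfunK // mulVg; exact: domL.
apply: (@Ck_eq _ _ _ _ _ ('D_((0, v) : 'rV[R]_n * 'rV[R]_n) (mul_rep psi phi c1)
    \o (fun p => (J p, p)))) => //.
  move=> p; rewrite inE => Up; have [rp dp] := Up.
  have dmp := (Sm 1%N).1 (J p, p) (dom p Up).
  apply: etrans (esym (derive_pair_snd v dmp)) _.
  have dy := cdom_cinv rp.
  apply: etrans _ (esym (left_ext_of_coord v aphi dy)).
  have -> : (fun q => mul_rep psi phi c1 (J p, q)) =
            rep phi c1 (lmul (cinv phi p)^-1%g).
    by apply/funext => q; rewrite /mul_rep /rep /= cfunK.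
  rewrite (cinvK rp); apply: deriveE.
  rewrite -[X in differentiable _ X](cinvK rp).
  apply: (differentiable_rep (smooth_map_lmul L _)) => //; first exact: atL.
  by rewrite mulVg; exact: domL.
apply: (Ck_comp (finite_frame_prod (@finite_frame_rV R n) (@finite_frame_rV R n))
  oU dom); last exact: (Sm k.+1).2.
by apply: Ck_pair => //; exact: Ck_id.
Qed.

(** In a chart, the Maurer-Cartan form on [X] is the sum of its values [th j] on the coordinate
    fields, weighted by the components of [X]. *)
Lemma smooth_frame_coef X i : smooth_vf L X -> smooth_fun L (frame_coef X i).
Proof.
move=> sX phi aphi k; have oU := @open_cran _ _ _ phi.
pose th j p :=
  left_ext (cinv phi p) (of_coord L phi (cinv phi p) (delta_mx 0 j)) 1%g.
have C : Ck k (cran phi) (fun p => \sum_j local_rep L phi X p 0 j *: th j p).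
  apply: Ck_sum => // j; apply: CkZ => //; last exact: smooth_maurer_cartan.
  by apply: Ck_row_coord => //; exact: sX.
apply: Ck_eq (Ck_row_coord i oU C) => // p; rewrite inE => rp /=.
rewrite /frame_coef -left_ext_sum.
rewrite -[X (cinv phi p)](coordK _ aphi (cdom_cinv rp)).
rewrite -/(local_rep L phi X p) {2}[local_rep L phi X p]row_sum_delta.
congr (left_ext _ _ _ _ _); apply: esym.
apply: etrans (linear_sum ('d _ _) _ _ _) _.
by apply: eq_bigr => j _; exact: (linearZZ ('d _ _)).
Qed.

End MaurerCartan.

(** * The solution bi-form of the [+] connection *)

Section PlusConnection.
Local Open Scope classical_set_scope.
Local Open Scope ring_scope.
Context {R : realType} {n : nat} {G : topologicalGroupCarrierType}.
Variable L : lie_group R n G.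
#[local] Opaque diff derive Defs.bracket Defs.killing Defs.left_ext.
Implicit Types (phi psi : chart R n G) (X Y Z : @vfield R n G).
Implicit Types (x y z : G) (u v w : 'rV[R]_n).

Local Notation left_ext := (left_ext L).
Local Notation killing := (killing L).
Local Notation left_frame := (left_frame L).

Let atL := chart_at_atlas L.
Let domL := chart_at_dom L.

Lemma bilinear_form_killing_left_ext x y :
  bilinear_form (fun u v => killing (left_ext x u) (left_ext y v)).
Proof.
apply: bilinear_form_killing => *;
  [exact: left_ext_left_invariant | exact: left_ext_left_invariant
  | exact: left_ext_linear | exact: left_ext_linear].
Qed.

(** Moves both vectors to the identity, so that one fixed bilinear form is applied to values of the
    Maurer-Cartan form, whose smoothness is known. *)
Lemma killing_left_ext1 x y u v :
  killing (left_ext x u) (left_ext y v) =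
  killing (left_ext 1%g (left_ext x u 1%g)) (left_ext 1%g (left_ext y v 1%g)).
Proof. by rewrite !left_ext_trans. Qed.

Lemma kappaC x u v : kappa L x u v = kappa L x v u.
Proof. apply: killingC; exact: left_ext_left_invariant. Qed.

Lemma kappa_nondegenerate x v : semisimple L ->
  (forall w, kappa L x v w = 0) -> v = 0.
Proof.
move=> ss k0; rewrite -(left_ext_self L x v); apply: ss => [|Y iY].
  exact: left_ext_left_invariant.
by rewrite -(left_invariant_ext x iY); exact: k0.
Qed.

(** The closed form of [varpi^+], reached through [solution_plusE]; on the diagonal it unfolds to
    [kappa]. *)
Definition plus_biform : @biform R n G :=
  fun x y v w => killing (left_ext x v) (left_ext y w).

Lemma plus_biform_left_invariant : left_invariant_biform L plus_biform.
Proof.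
move=> x y z1 z2 X Y iX iY; rewrite /bieval /plus_biform.
by rewrite !(left_invariant_ext _ iX) !(left_invariant_ext _ iY).
Qed.

Lemma smooth_plus_biform : smooth_biform L plus_biform.
Proof.
split=> [x y|phi psi aphi apsi v u k].
  exact: bilinear_form_killing_left_ext.
rewrite /plus_biform /=; under eq_fun do rewrite killing_left_ext1.
have oU : open (cran phi `*` cran psi).
  rewrite openE => -[p q] [/= rp rq]; exists (cran phi, cran psi) => //=.
  by split; apply: open_nbhs_nbhs; split=> //; exact: open_cran.
have [b1 b2] := (@finite_frame_rV R n, bilinear_form_killing_left_ext 1%g 1%g).
apply: (Ck_bilinear_form b2 oU).
  apply: (Ck_comp b1 oU) (smooth_maurer_cartan v aphi k) => [[p q] []//|].
  by apply: Ck_linear => p; exact: cvg_fst.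
apply: (Ck_comp b1 oU) (smooth_maurer_cartan u apsi k) => [[p q] []//|].
by apply: Ck_linear => p; exact: cvg_snd.
Qed.

Lemma plus_biform_contrast : semisimple L -> contrast_biform L plus_biform.
Proof.
move=> ss; split; first exact: smooth_plus_biform.
split=> [x|x|x v|phi aphi v w k].
- exact: bilinear_form_killing_left_ext.
- exact: kappaC.
- exact: kappa_nondegenerate.
- rewrite /restr_diag /plus_biform /=; under eq_fun do rewrite killing_left_ext1.
  apply: (Ck_bilinear_form (bilinear_form_killing_left_ext 1%g 1%g)).
  + exact: open_cran.
  + exact: smooth_maurer_cartan.
  + exact: smooth_maurer_cartan.
Qed.

(** * The [+] connection in the left-invariant frame *)

Section Plus.
Variable nabla : @connection R n G.
Hypothesis cp : cartan_plus L nabla.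

(** The definition of [nabla] on left-invariant fields extends to any smooth direction [Z] by
    linearity over functions, after decomposing [Z] in the frame. *)
Lemma cartan_plus_left_frame Z i x : smooth_vf L Z ->
  nabla Z (left_frame i) x = 0.
Proof.
have [[_ nD nZ _ _] n0] := cp; move=> sZ.
have sE j := (@smooth_left_frame _ _ _ L j).
have -> : Z = (fun x => \sum_j frame_coef L Z j x *: left_frame j x).
  by apply/funext => y; exact: frame_decomposition.
have sf j := smooth_frame_coef j sZ.
elim: (index_enum _) => [|j r IH].
  under eq_fun do rewrite big_nil.
  (* The zero direction is treated as [0] times a frame field. *)
  have := nZ _ _ _ (@smooth_fun_cst _ _ _ L 0) (sE i) (sE i) x.
  by rewrite scale0r; under eq_fun do rewrite scale0r.
under eq_fun do rewrite big_cons.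
rewrite nD //; [|exact: smooth_vfZ|exact: smooth_vf_sum].
by rewrite IH addr0 nZ // n0 ?scaler0 //; exact: left_frame_left_invariant.
Qed.

(** The frame is parallel in every direction, so the Leibniz rule leaves only the derivatives of the
    coefficients of [X]. *)
Lemma cartan_plusE Z X x : smooth_vf L Z -> smooth_vf L X ->
  nabla Z X x = \sum_i lie_deriv L Z (frame_coef L X i) x *: left_frame i x.
Proof.
have [[_ _ _ nD nZ] n0] := cp; move=> sZ sX.
have sE j := (@smooth_left_frame _ _ _ L j).
have EX : X = (fun x => \sum_j frame_coef L X j x *: left_frame j x).
  by apply/funext => y; exact: frame_decomposition.
rewrite {1}EX; have sf j := smooth_frame_coef j sX.
elim: (index_enum _) => [|j r IH].
  (* The empty sum is written as the product of the function [0] with the zero field, so that the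
     Leibniz rule gives its derivative. *)
  have -> : (fun y => \sum_(j <- [::]) frame_coef L X j y *: left_frame j y) =
      (fun y => 0 *: (fun=> 0) y).
    by apply/funext => y; rewrite big_nil scale0r.
  rewrite big_nil nZ //; last exact: smooth_vf0.
    by rewrite scaler0 scale0r addr0.
  exact: smooth_fun_cst.
have -> : (fun y => \sum_(k <- j :: r) frame_coef L X k y *: left_frame k y) =
    (fun y => frame_coef L X j y *: left_frame j y +
              \sum_(k <- r) frame_coef L X k y *: left_frame k y).
  by apply/funext => y; rewrite big_cons.
rewrite big_cons nD //; [|exact: smooth_vfZ|exact: smooth_vf_sum].
rewrite IH; congr (_ + _); apply: etrans (nZ _ _ _ (sf j) sZ (sE j) x) _.
by rewrite cartan_plus_left_frame // scaler0 addr0.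
Qed.

Lemma lie_deriv_sum Z (f : 'I_n -> G -> R) (k : 'I_n -> R) x :
  (forall i, smooth_fun L (f i)) ->
  lie_deriv L Z (fun y => \sum_i f i y * k i) x =
  \sum_i lie_deriv L Z (f i) x * k i.
Proof.
move=> sf; set phi := chart_at L x.
have d i : derivable (f i \o cinv phi : 'rV[R]_n -> R^o) (phi x) (Z x).
  apply: diff_derivable; have [df _] := sf i _ (atL x) 1%N.
  by apply: df; exact/cran_dom/domL.
rewrite /lie_deriv -/phi.
have -> : ((fun y => \sum_i f i y * k i) \o cinv phi : 'rV[R]_n -> R^o) =
    \sum_i (k i *: (f i \o cinv phi : 'rV[R]_n -> R^o)).
  by apply/funext => p; rewrite fct_sumE; apply: eq_bigr => i _; rewrite mulrC.
rewrite derive_sum; last by move=> i; exact: derivableZ.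
by apply: eq_bigr => i _; rewrite deriveZ // mulrC.
Qed.

(** On the diagonal the two bracket terms cancel. What remains is the derivative along [Z] of the
    first variable, the second being frozen at [x]; in the frame, both sides become the derivatives
    of the coefficients of [X] paired with the constants [k i]. *)
Lemma plus_biform_integrates : integrates L plus_biform (kappa L) nabla.
Proof.
split=> //; split; first exact: cp.1.
move=> Z X Y sZ sX sY x; rewrite /lie_left subrK cartan_plusE //.
pose k i := killing (left_frame i) (left_ext x (Y x)).
(* The base point [y] disappears on the right, so only the coefficients [a] are left to
   differentiate. *)
have KS (a : 'I_n -> R) y : killing
    (left_ext y (\sum_i a i *: left_frame i y)) (left_ext x (Y x)) =
    \sum_i a i * k i.
  have [bly _] := bilinear_form_killing_left_ext y x.
  pose B : {scalar 'rV[R]_n} :=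
    HB.pack (fun v => killing (left_ext y v) (left_ext x (Y x)))
    (GRing.isLinear.Build _ _ _ _ _ (bly (Y x))).
  rewrite -[LHS]/(B _) linear_sum; apply: eq_bigr => i _; rewrite linearZ /=.
  by rewrite left_ext_trans.
have -> : (fun x' => bieval plus_biform X Y x' x) =
    (fun y => \sum_i frame_coef L X i y * k i).
  apply/funext => y.
  by rewrite /bieval /plus_biform (frame_decomposition L X y) KS.
rewrite lie_deriv_sum => [|i]; last exact: smooth_frame_coef.
by rewrite /restr_diag /plus_biform KS.
Qed.

(** The hypothesis on [PP] itself supplies a curve and a parallel field along it. Since [nabla]
    kills the frame, the coefficients of that field have zero derivative and are constant. *)
Lemma transport_plus PP x y v : is_parallel_transport L nabla PP ->
  PP y x v = left_ext x v y.
Proof.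
move=> /(_ x y v (PP y x v))[_ /(_ erefl)].
move=> [c [V [_ c0 c1 [a Ha] [V0 V1]]]].
have a0 i t : is_derive (t : R^o) (1 : R^o) (a i : R^o -> R^o) 0.
  have [da _ E] := Ha t; split; first exact: da.
  rewrite -derive1E.
  suff /rowP/(_ i) : \row_j derive1 (a j) t = 0 by rewrite !mxE.
  (* The frame is independent at [c t], so the vanishing of the combination forces each coefficient
     to vanish. *)
  apply: (@left_ext_inj _ _ _ L 1%g (c t)).
  rewrite -left_frame_sum -[RHS]E; apply: eq_bigr => j _.
  rewrite cp.2 ?scaler0 ?addr0 //; first exact: left_ext_left_invariant.
  exact: left_frame_left_invariant.
have ac i : a i 1 = a i 0 by exact: (is_derive_0_is_cst _ _ (a0 i)).
have VE t : V t = left_ext 1%g (\row_i a i t) (c t).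
  by have [_ -> _] := Ha t; rewrite left_frame_sum.
rewrite -V1 -V0 !VE c0 c1 left_ext_trans.
by congr (left_ext _ _ _); apply/rowP => i; rewrite !mxE.
Qed.

Lemma solution_plusE PP : is_parallel_transport L nabla PP ->
  solution_biform L PP = plus_biform.
Proof.
move=> H; apply/funext => x; apply/funext => y; apply/funext => v.
apply/funext => w.
by rewrite /solution_biform /kappa (transport_plus _ _ _ H) left_ext_trans.
Qed.

(** Translating the first point by [y * x^-1] moves [(x, y)] to [(y, y)], where the bi-form is
    prescribed to be [kappa]. *)
Lemma plus_biform_unique (w : @biform R n G) : left_invariant_biform L w ->
  integrates L w (kappa L) nabla -> w = plus_biform.
Proof.
move=> iw [wk _]; apply/funext => x; apply/funext => y; apply/funext => v.
apply/funext => u.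
have iv := left_ext_left_invariant L x v.
have iu := left_ext_left_invariant L y u.
have := iw x y (y * x^-1)%g 1%g _ _ iv iu.
rewrite /bieval -mulgA mulVg mulg1 mul1g !left_ext_self => <-.
apply: etrans (wk y _ _) _.
by rewrite /kappa /plus_biform left_ext_trans.
Qed.

End Plus.

End PlusConnection.

(** * Transport for the [-] connection *)

Section MinusConnection.
Local Open Scope classical_set_scope.
Local Open Scope ring_scope.
Context {R : realType} {n : nat} {G : topologicalGroupCarrierType}.
Variable L : lie_group R n G.
#[local] Opaque diff derive Defs.bracket Defs.killing Defs.left_ext.
Implicit Types (phi psi : chart R n G) (X Y Z : @vfield R n G).
Implicit Types (x y z : G) (u v w : 'rV[R]_n).

Local Notation lmul z := (fun y : G => (z * y)%g).
Local Notation left_ext := (left_ext L).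
Local Notation left_frame := (left_frame L).

Let atL := chart_at_atlas L.

Lemma curve_rep phi psi z (c : R -> G) (t : R^o) : continuous c ->
  cdom phi (c t) -> \forall s \near t,
    (rep phi psi (lmul z) \o (phi \o c)) s = (psi \o (fun s => (z * c s)%g)) s.
Proof.
move=> cc dc; have : nbhs t (c @^-1` cdom phi).
  by apply: cc; apply: open_nbhs_nbhs; split=> //; exact: cdom_open.
by apply: filterS => s ds; rewrite /rep /= cfunK.
Qed.

Lemma smooth_curve_lmul z (c : R -> G) : smooth_curve L c ->
  smooth_curve L (fun t => (z * c t)%g).
Proof.
move=> [cc sc]; have cz := (smooth_map_lmul L z).1.
have czc : continuous (fun t => (z * c t)%g).
  by move=> t; apply: continuous_comp; [exact: cc | exact: cz].
split=> // psi apsi k; apply: Ck_local => t0 dt0.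
(* The factorization through a chart around [c t0] is only valid near [t0], hence the passage to a
   local statement. *)
pose phi := chart_at L (c t0).
pose U : set R^o := [set t | cdom phi (c t) /\ cdom psi (z * c t)%g].
have oU : open U.
  rewrite openE => t [d1 d2]; apply: (@filterI _ (nbhs t)).
    by apply: cc; apply: open_nbhs_nbhs; split=> //; exact: cdom_open.
  by apply: czc; apply: open_nbhs_nbhs; split=> //; exact: cdom_open.
exists U; first by split=> //; exact: (chart_at_dom L).
have S1 : Ck k U (phi \o c : R^o -> 'rV[R]_n).
  by apply: Ck_subset (sc phi (atL _) k) => t [].
have S2 := (smooth_map_lmul L z).2 phi psi (atL _) apsi k.
have sub : U `<=` (phi \o c) @^-1` rep_dom phi psi (lmul z).
  by move=> t [d1 d2]; exact: rep_dom_cfun.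
apply: Ck_eq (Ck_comp (@finite_frame_rV R n) oU sub S1 S2) => // t.
by rewrite inE => -[d1 d2]; rewrite /rep /= cfunK.
Qed.

Lemma velocity_lmul z (c : R -> G) t : smooth_curve L c ->
  velocity L (fun s => (z * c s)%g) t
  = tangent_map L (lmul z) (c t) (velocity L c t).
Proof.
move=> [cc sc]; pose phi := chart_at L (c t); pose psi := chart_at L (z * c t)%g.
have dphi : cdom phi (c t) by exact: (chart_at_dom L).
have dpsi : cdom psi (z * c t)%g by exact: (chart_at_dom L).
have dc : differentiable (phi \o c : R^o -> 'rV[R]_n) t.
  by have [dc _] := sc phi (atL _) 1%N; exact: dc.
have df : differentiable (rep phi psi (lmul z)) ((phi \o c) t).
  exact: (differentiable_rep (smooth_map_lmul L z) (atL _) (atL _)).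
have N := curve_rep psi z cc dphi.
rewrite /velocity !derive1E -/phi -/psi.
apply: etrans (esym (near_eq_derive _ N)) _.
apply: etrans (deriveE _ (differentiable_comp dc df)) _.
apply: etrans (congr1 (@^~ 1) (diff_comp dc df)) _.
by rewrite (deriveE _ dc).
Qed.

(** * Left translation of fields parallel for the [-] connection *)

Section Minus.
Variable nabla : @connection R n G.
Hypothesis cm : cartan_minus L nabla.

Lemma tangent_left_frame z i y :
  left_frame i (z * y)%g = tangent_map L (lmul z) y (left_frame i y).
Proof. exact: left_frame_left_invariant. Qed.

(** The translated field has the same coefficients [a] in the left-invariant frame, along the
    translated curve. *)
Lemma transports_lmul z x y v w : transports L nabla x y v w ->
  transports L nabla (z * x)%g (z * y)%g
    (tangent_map L (lmul z) x v) (tangent_map L (lmul z) y w).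
Proof.
move=> [c [V [sc c0 c1 [a Ha] [V0 V1]]]].
exists (fun t => (z * c t)%g), (fun t => tangent_map L (lmul z) (c t) (V t)).
have TS (I : finType) (b : I -> R) (f : I -> 'rV[R]_n) p :
    tangent_map L (lmul z) p (\sum_i b i *: f i) =
    \sum_i b i *: tangent_map L (lmul z) p (f i).
  apply: etrans (linear_sum ('d _ _) _ _ _) _.
  by apply: eq_bigr => i _; exact: (linearZZ ('d _ _)).
split.
- exact: smooth_curve_lmul.
- by rewrite c0.
- by rewrite c1.
- exists a => t; have [da Vt E] := Ha t; split; first exact: da.
    by rewrite Vt TS; apply: eq_bigr => i _; rewrite tangent_left_frame.
  (* The new transport equation is the image of the old one under the tangent map of the
     translation, matched term by term. *)
  have T0 : tangent_map L (lmul z) (c t) 0 = 0 by exact: (linear0 ('d _ _)).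
  apply: etrans _ (etrans (congr1 (tangent_map L (lmul z) (c t)) E) T0).
  apply: etrans _ (esym (linear_sum ('d _ _) _ _ _)).
  apply: eq_bigr => i _; apply: etrans _ (esym (linearD ('d _ _) _ _)).
  have il := left_ext_left_invariant L (c t) (velocity L c t).
  have ie := @left_frame_left_invariant _ _ _ L i.
  congr (_ + _); apply: etrans _ (esym (linearZZ ('d _ _) _ _)).
    by rewrite tangent_left_frame.
  (* The velocities before and after translation have the same left-invariant extension, so the same
     bracket occurs at both points, and it is left-invariant. *)
  rewrite (velocity_lmul z t sc) left_ext_tangent !cm.2 //.
  by rewrite (bracket_left_invariant il ie).
- by rewrite V0 V1 c0 c1.
Qed.

(** A transport from [x] to [y] translates to one from [z * x] to [z * y]; path-independence
    identifies its end value with that of [PM]. The vectors compared by [kappa] then have the same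
    left-invariant extensions as before. *)
Lemma solution_minus_diag_left_invariant PM : is_parallel_transport L nabla PM ->
  diag_left_invariant_biform L (solution_biform L PM).
Proof.
move=> H x y z X Y iX iY; rewrite /bieval /solution_biform /kappa iX iY.
have := transports_lmul z ((H x y (X x) (PM y x (X x))).2 erefl).
by move=> /H <-; rewrite !left_ext_tangent.
Qed.

End Minus.

End MinusConnection.

Theorem proposition5p4 (R : realType) (n : nat)
    (G : topologicalGroupCarrierType) (L : lie_group R n G)
    (nablaP nablaM : @connection R n G)
    (PP PM : G -> G -> 'rV[R]_n -> 'rV[R]_n) :
  semisimple L ->
  cartan_plus L nablaP -> cartan_minus L nablaM ->
  is_parallel_transport L nablaP PP -> is_parallel_transport L nablaM PM ->
  [/\ left_invariant_biform L (solution_biform L PP),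
      contrast_biform L (solution_biform L PP)
        /\ integrates L (solution_biform L PP) (kappa L) nablaP
    & forall w : @biform R n G,
        left_invariant_biform L w -> contrast_biform L w ->
        integrates L w (kappa L) nablaP ->
        forall x y u v, w x y u v = solution_biform L PP x y u v]
  /\ diag_left_invariant_biform L (solution_biform L PM).
Proof.
move=> ss cp cm HP HM; split; last exact: solution_minus_diag_left_invariant HM.
rewrite (solution_plusE cp HP); split.
- exact: plus_biform_left_invariant.
- by split; [exact: plus_biform_contrast | exact: plus_biform_integrates].
- by move=> w iw _ wint x y u v; rewrite (plus_biform_unique iw wint).
Qed.
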